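(* Let $n\ge 2$. In the variety $\mathfrak{Fil}^n_{n+1}$ of $(n+1)$-dimensional complex $n$-ary Filippov algebras, whose isomorphism classes are represented by $\mathbb{C}^{n+1}$, $B$, $C_1$, $C_2(\alpha)$ ($\alpha\in\mathbb{C}$), $C_3$ and $D_r$ ($3\le r\le n+1$), the primary degenerations are, up to isomorphism, exactly the following: (1) $D_r\to D_{r-1}$ for $4\le r\le n+1$; (2) $D_3\to C_1$; (3) $C_1\to B$; (4) $C_2(\alpha)\to B$ for every $\alpha\in\mathbb{C}$; (5) $C_2(-1/4)\to C_3$; (6) $B\to\mathbb{C}^{n+1}$; (7) $C_3\to\mathbb{C}^{n+1}$.
   Context: All vector spaces are over $\mathbb{C}$. An $n$-ary algebra $\mathbb{A}$ is a vector space with an $n$-linear map $[\cdot,\dots,\cdot]:\mathbb{A}^n\to\mathbb{A}$. It is a Filippov ($n$-Lie) algebra if $[x_1,\dots,x_n]=(-1)^\sigma[x_{\sigma(1)},\dots,x_{\sigma(n)}]$ for all $\sigma\in S_n$ (where $(-1)^\sigma$ is the sign of $\sigma$) and $[[x_1,\dots,x_n],y_2,\dots,y_n]=\sum_{i=1}^n[x_1,\dots,x_{i-1},[x_i,y_2,\dots,y_n],x_{i+1},\dots,x_n]$ for all $x_1,\dots,x_n,y_2,\dots,y_n\in\mathbb{A}$. Let $\mathbb{V}$ be an $(n+1)$-dimensional vector space. $\mathfrak{Fil}^n_{n+1}\subset\mathrm{Hom}(\mathbb{V}^{\otimes n},\mathbb{V})$ is the Zariski-closed subset of all Filippov algebra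 structures on $\mathbb{V}$. $GL(\mathbb{V})$ acts on it by $(g*\mu)(x_1\otimes\dots\otimes x_n)=g\mu(g^{-1}x_1\otimes\dots\otimes g^{-1}x_n)$; the orbits $O(\mu)$ correspond to isomorphism classes of algebras. If $\mu,\lambda$ represent algebras $\mathbb{A},\mathbb{B}$, then $\mathbb{A}\to\mathbb{B}$ ($\mathbb{A}$ degenerates to $\mathbb{B}$) means $\lambda\in\overline{O(\mu)}$ (Zariski closure). The degeneration is proper if $\mathbb{A}\not\cong\mathbb{B}$. A proper degeneration $\mathbb{A}\to\mathbb{B}$ is primary if there is no $\mathbb{D}$ such that $\mathbb{A}\to\mathbb{D}$ and $\mathbb{D}\to\mathbb{B}$ are both proper degenerations. The algebras have basis $e_1,\dots,e_{n+1}$ and the following products; products of basis elements that cannot be obtained from the listed ones by anticommutativity are zero: - $\mathbb{C}^{n+1}$: zero multiplication. - $B$: $[e_2,\dots,e_{n+1}]=e_1$. - $C_1$: $[e_2,\dots,e_{n+1}]=e_1$, $[e_1,e_3,\dots,e_{n+1}]=e_2$. - $C_2(\alpha)$, $\alpha\in\mathbb{C}$: $[e_2,\dots,e_{n+1}]=\alpha e_1+e_2$, $[e_1,e_3,\dots,e_{n+1}]=e_2$. - $C_3$: $[e_1,e_3,\dots,e_{n+1}]=e_1$, $[e_2,e_3,\dots,e_{n+1}]=e_2$. - $D_r$, $3\le r\le n+1$: $[e_1,\dots,e_{i-1},e_{i+1},\dots,e_{n+1}]=e_i$ for $1\le i\le r$. It is a known classification that every $(n+1)$-dimensional complex $n$-ary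 Filippov algebra is isomorphic to exactly one algebra in this list. *)

(* Defs.v *)
From mathcomp Require Import all_boot all_order all_fingroup all_algebra.
From mathcomp Require Import mpoly.

Set Implicit Arguments.
Unset Strict Implicit.
Unset Printing Implicit Defensive.

Import GRing.Theory.
Local Open Scope ring_scope.

Section FilippovVariety.

Variables (F : fieldType) (n : nat).

(* The underlying (n+1)-dimensional space is F^(n+1). *)
Local Notation V := 'cV[F]_n.+1.

Definition nary_op := {ffun 'I_n -> V} -> V.

Implicit Types (mu lam : nary_op) (x y : {ffun 'I_n -> V}).

(* x with its k-th entry (counting from 0) replaced by v. *)
Definition put x (k : nat) (v : V) : {ffun 'I_n -> V} :=
  [ffun j : 'I_n => if j == k :> nat then v else x j].

Definition multilinear mu : Prop :=
  forall x (i : 'I_n), linear (fun v : V => mu (put x i v)).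

Definition anticommutative mu : Prop :=
  forall (s : 'S_n) x, mu x = (-1) ^+ s *: mu [ffun i => x (s i)].

(* [z, y_2, ..., y_n] is mu (put y 0 z); the entry y_1 of y is not used. *)
Definition filippov_identity mu : Prop :=
  forall x y, mu (put y 0 (mu x))
            = \sum_(i < n) mu (put x i (mu (put y 0 (x i)))).

Definition filippov mu : Prop :=
  [/\ multilinear mu, anticommutative mu & filippov_identity mu].

(* The basis vector e_k of F^(n+1), numbered from 1. *)
Definition evec (k : nat) : V := \col_(i < n.+1) (i.+1 == k)%:R.

(* Coordinates on Hom(V^(tensor n), V): the coordinate (s, k) of mu is the
   k-th component of the product of the basis vectors selected by s. *)
Definition sc_index : finType := ({ffun 'I_n -> 'I_n.+1} * 'I_n.+1)%type.

Definition struct_const mu (t : sc_index) : F :=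
  mu [ffun i => evec (t.1 i).+1] t.2 0.

Definition poly_value (p : {mpoly F[#|sc_index|]}) mu : F :=
  p.@[fun k => struct_const mu (enum_val k)].

(* Only the trace of Z on the space of n-linear maps is meaningful. *)
Definition zariski_closed (Z : nary_op -> Prop) : Prop :=
  exists I : {mpoly F[#|sc_index|]} -> Prop,
    forall mu, multilinear mu ->
      (Z mu <-> forall p, I p -> poly_value p mu = 0).

Definition zariski_closure (S : nary_op -> Prop) lam : Prop :=
  multilinear lam /\
  forall Z, zariski_closed Z -> (forall mu, S mu -> Z mu) -> Z lam.

Definition gl_act (g : 'M[F]_n.+1) mu : nary_op :=
  fun x => g *m mu [ffun i => invmx g *m x i].

Definition orbit mu lam : Prop :=
  exists2 g : 'M[F]_n.+1, g \in unitmx & lam =1 gl_act g mu.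

Definition isomorphic mu lam : Prop :=
  exists2 g : 'M[F]_n.+1, g \in unitmx &
    forall x, g *m mu x = lam [ffun i => g *m x i].

Definition degenerates mu lam : Prop := zariski_closure (orbit mu) lam.

Definition proper_degeneration mu lam : Prop :=
  degenerates mu lam /\ ~ isomorphic mu lam.

Definition primary_degeneration mu lam : Prop :=
  [/\ filippov mu, filippov lam, proper_degeneration mu lam &
      ~ exists nu, [/\ filippov nu, proper_degeneration mu nu
                     & proper_degeneration nu lam]].

(* The anticommutative n-linear product whose value on
   e_1, ..., e_(k-1), e_(k+1), ..., e_(n+1) is c k: the coefficient of c k is
   the minor, with row k deleted, of the matrix with columns x_1, ..., x_n. *)
Definition alt_op (c : nat -> V) : nary_op :=
  fun x => \sum_(k < n.+1) \det (row' k (\matrix_(i, j) x j i 0)) *: c k.+1.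

Lemma alt_op_table c (k : 'I_n.+1) :
  alt_op c [ffun j : 'I_n => evec (lift k j).+1] = c k.+1.
Proof.
rewrite /alt_op (bigD1 k) // big1 => [|i neq_ik].
  apply: etrans (addr0 _) _; rewrite (_ : row' k _ = 1%:M) ?det1 ?scale1r //.
  apply/matrixP=> i j; rewrite !mxE ffunE mxE eqSS.
  by rewrite (inj_eq (@ord_inj _)) (inj_eq (@lift_inj _ k)).
have [l def_k _] := unlift_some neq_ik.
rewrite (expand_det_row _ l) big1 ?scale0r // => j _.
rewrite !mxE ffunE mxE eqSS (inj_eq (@ord_inj _)) -def_k.
by rewrite (negPf (neq_lift k j)) mul0r.
Qed.

Lemma alt_op_anticommutative c : anticommutative (alt_op c).
Proof.
move=> s x; rewrite /alt_op scaler_sumr; apply: eq_bigr => k _.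
rewrite scalerA; congr (_ *: _).
set A := row' k _; rewrite (_ : row' k _ = col_perm s A); last first.
  by apply/matrixP=> i j; rewrite !mxE ffunE.
rewrite col_permE det_mulmx det_perm odd_permV.
by rewrite mulrCA -signr_addb addbb mulr1.
Qed.

Definition alg_0 : nary_op := alt_op (fun _ => 0).

Definition alg_B : nary_op :=
  alt_op (fun k => match k with 1 => evec 1 | _ => 0 end).

Definition alg_C1 : nary_op :=
  alt_op (fun k => match k with 1 => evec 1 | 2 => evec 2 | _ => 0 end).

Definition alg_C2 (a : F) : nary_op :=
  alt_op (fun k => match k with
                   | 1 => a *: evec 1 + evec 2
                   | 2 => evec 2
                   | _ => 0
                   end).

(* The product omitting e_1 is e_2, and the product omitting e_2 is e_1. *)
Definition alg_C3 : nary_op :=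
  alt_op (fun k => match k with 1 => evec 2 | 2 => evec 1 | _ => 0 end).

Definition alg_D (r : nat) : nary_op :=
  alt_op (fun k => if (1 <= k <= r)%N then evec k else 0).

Inductive listed_degeneration : nary_op -> nary_op -> Prop :=
| listed_D_D r of (4 <= r <= n.+1)%N :
    listed_degeneration (alg_D r) (alg_D r.-1)
| listed_D3_C1 : listed_degeneration (alg_D 3) alg_C1
| listed_C1_B : listed_degeneration alg_C1 alg_B
| listed_C2_B (a : F) : listed_degeneration (alg_C2 a) alg_B
| listed_C2_C3 : listed_degeneration (alg_C2 (- (1 / 4%:R))) alg_C3
| listed_B_0 : listed_degeneration alg_B alg_0
| listed_C3_0 : listed_degeneration alg_C3 alg_0.

End FilippovVariety.

(* Main.v *)
Require Import Defs.
From mathcomp Require Import all_boot all_order all_algebra.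
From mathcomp Require Import reals complex.
From mathcomp Require Import fingroup perm mpoly ring.

Set Implicit Arguments.
Unset Strict Implicit.
Unset Printing Implicit Defensive.

Import GRing.Theory Num.Theory.
Local Open Scope ring_scope.

(** Fix a basis of the (n+1)-dimensional space V. The n-th exterior power of V
is dual to V up to the determinant: x_1, ..., x_n go to the vector w(x) of
signed maximal minors ([cross]), for which z . w(x) = det [z | x]. Hence every
anticommutative n-linear product is x |-> M w(x) for a unique square matrix M
([form_op], [form_mx], [form_opK]), which should be seen as a bilinear form on
the dual of V.

An isomorphism g replaces M by det(g)^-1 g M g^T. Multiplying g by a scalar c
multiplies this by c^(1-n), and 1-n is not zero, so over an algebraically
closed field every scalar factor can be absorbed: isomorphism of algebras is
congruence of matrices ([isomorphicP]), and degeneration is membership in the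
Zariski closure of a congruence class ([degeneratesP]).

The Filippov identity says that the maps z |-> [z, y_2, ..., y_n] are
derivations. These maps are M W with W skew-symmetric of rank at most two, and
the identity becomes M W (M - M^T) = tr (M W) M ([filippov_identity_form]).
With A = M - M^T, this means that the wedge product of A with any row of M is
zero ([filippov_cyclic]). So either A = 0 and M is symmetric, or A is a
decomposable 2-form and M is carried by the plane of A ([corner_mxP]).
Symmetric matrices are classified by their rank r: these are the algebra D_r,
together with C_1, B and the zero algebra for r = 2, 1, 0. The others are
non-symmetric 2 x 2 forms: the alternating one is C_3, and any other is exactly
one C_2(a) ([asymmetric_mx2]).

Degenerations between normal forms are produced by curves of congruent matrices
extended to t = 0 ([above_closure]). Four closed conditions rule out all others
([closure_above]): symmetry, skew-symmetry, a bound on the rank, and, for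
C_2(a), the proportionality between the 2 x 2 minors of M and the products of
the coordinates of A ([quadric]), with a factor which determines a. The
resulting partial order on normal forms ([above]) consists of the chain of
ranks, the forms C_2(a), which are pairwise incomparable and lie just above
rank one, and C_3, which lies between C_2(-1/4) and zero. Primary degenerations
are its covering pairs ([coversP]), and these are the listed ones. *)

(** * Anticommutative products as matrices *)

Section CrossProduct.

Variables (F : fieldType) (n : nat).

Local Notation V := 'cV[F]_n.+1.
Implicit Types (x y : {ffun 'I_n -> V}) (z v : V) (M g : 'M[F]_n.+1).
Implicit Types (mu : nary_op F n).

Definition cols x : 'M[F]_(n.+1, n) := \matrix_(i, j) x j i 0.

(** For n = 2 this is the usual cross product; the sign of the k-th minor is
the one that makes [cross_det] hold. *)
Definition cross x : V := \col_(k < n.+1) ((-1) ^+ k * \det (row' k (cols x))).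

Definition form_op M : nary_op F n := fun x => M *m cross x.

Definition bordered z x : 'M[F]_n.+1 := row_mx z (cols x).

Lemma bordered0 z x i : bordered z x i 0 = z i 0.
Proof.
rewrite (_ : 0 = lshift n (0 : 'I_1) :> 'I_n.+1); last exact/val_inj.
exact: (row_mxEl z (cols x) i 0).
Qed.

Lemma borderedS z x i (j : 'I_n) : bordered z x i (lift 0 j) = x j i 0.
Proof.
rewrite (_ : lift 0 j = rshift 1 j :> 'I_n.+1); last exact/val_inj.
by rewrite (row_mxEr z (cols x) i j) mxE.
Qed.

(** Laplace expansion along the first column. As z is arbitrary, this formula
determines [cross x], and identities about [cross] become identities about
determinants. *)
Lemma cross_det z x : z^T *m cross x = (\det (bordered z x))%:M.
Proof.
apply/matrixP=> i j; rewrite !ord1 mxE [RHS]mxE mulr1n (expand_det_col _ 0).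
apply: eq_bigr => k _; rewrite bordered0 /cofactor addn0 2!mxE.
congr (_ * (_ * \det _)).
by apply/matrixP=> a b; rewrite 2![RHS]mxE borderedS !mxE.
Qed.

Lemma eq_dual u v : (forall z : V, z^T *m u = z^T *m v) -> u = v.
Proof.
move=> eq_uv; apply/matrixP=> i j; rewrite !ord1.
have /(congr1 (fun A : 'M_1 => A 0 0)) := eq_uv (delta_mx i 0).
by rewrite trmx_delta -!rowE !mxE.
Qed.

Lemma cols_act g x : cols [ffun i => g *m x i] = g *m cols x.
Proof.
apply/matrixP=> i j; rewrite !mxE ffunE mxE.
by apply: eq_bigr => k _; rewrite mxE.
Qed.

(** By [cross_det], pairing with z turns the claim into det [z | g x] = det g *
det [g^-1 z | x]. *)
Lemma cross_act g x : g \in unitmx ->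
  cross [ffun i => g *m x i] = \det g *: ((invmx g)^T *m cross x).
Proof.
move=> g_unit; apply: eq_dual => z.
rewrite -scalemxAr mulmxA -trmx_mul !cross_det scale_scalar_mx.
have {1}-> : z = g *m (invmx g *m z) by rewrite mulKVmx.
by rewrite /bordered cols_act -mul_mx_row det_mulmx.
Qed.

Definition setcol (X : 'M[F]_n.+1) (j : 'I_n.+1) v : 'M[F]_n.+1 :=
  \matrix_(a, b) if b == j then v a 0 else X a b.

(** The adjugate is made of cofactors, so this is the expansion along column j.
It shows that the determinant is linear in that column. *)
Lemma det_setcol X j v : \det (setcol X j v) = (\adj X *m v) j 0.
Proof.
rewrite (expand_det_col _ j) mxE; apply: eq_bigr => i _.
rewrite !mxE eqxx mulrC; congr (_ * _); rewrite /cofactor; congr (_ * \det _).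
by apply/matrixP=> a b; rewrite !mxE eq_sym (negPf (neq_lift _ _)).
Qed.

(** The derivative of the determinant in the direction g X: the sum is the
trace of adj X * g * X, and X * adj X is scalar. *)
Lemma sum_det_setcol g (X : 'M[F]_n.+1) :
  \sum_j \det (setcol X j (g *m col j X)) = \tr g * \det X.
Proof.
transitivity (\tr (\adj X *m g *m X)).
  apply: eq_bigr => j _; rewrite det_setcol colE !mulmxA.
  by rewrite -colE mxE.
by rewrite mxtrace_mulC mulmxA mul_mx_adj mul_scalar_mx mxtraceZ mulrC.
Qed.

Lemma bordered_put z x (i : 'I_n) v :
  bordered z (put x i v) = setcol (bordered z x) (lift 0 i) v.
Proof.
apply/matrixP=> a b; rewrite [RHS]mxE; case: (unliftP 0 b) => [j|] ->.
  rewrite !borderedS ffunE (inj_eq (@lift_inj _ 0)).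
  by rewrite -(inj_eq val_inj) /=; case: ifP.
by rewrite !bordered0 (negPf (neq_lift _ _)).
Qed.

Lemma bordered_setcol0 z z' x : bordered z x = setcol (bordered z' x) 0 z.
Proof.
apply/matrixP=> a b; rewrite [RHS]mxE; case: (unliftP 0 b) => [j|] ->.
  by rewrite !borderedS eq_sym (negPf (neq_lift _ _)).
by rewrite !bordered0 eqxx.
Qed.

Lemma cross_put_linear x (i : 'I_n) : linear (fun v => cross (put x i v)).
Proof.
move=> a u v; apply: eq_dual => z; rewrite mulmxDr -scalemxAr !cross_det.
rewrite !bordered_put !det_setcol mulmxDr -scalemxAr scale_scalar_mx.
by rewrite [in LHS]mxE [X in X + _]mxE raddfD.
Qed.

Lemma form_op_multilinear M : multilinear (form_op M).
Proof.
by move=> x i a u v; rewrite /form_op cross_put_linear mulmxDr scalemxAr.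
Qed.

Lemma form_op_anticommutative M : anticommutative (form_op M).
Proof.
move=> s x; rewrite /form_op scalemxAr; congr (_ *m _).
apply/matrixP=> k j; rewrite !mxE mulrCA; congr (_ * _).
set A := row' k _; rewrite (_ : row' k _ = col_perm s A); last first.
  by apply/matrixP=> a b; rewrite !mxE ffunE.
rewrite col_permE det_mulmx det_perm odd_permV.
by rewrite mulrCA -signr_addb addbb mulr1.
Qed.

Lemma evecE (k : 'I_n.+1) : evec F n k.+1 = delta_mx k 0.
Proof. by apply/matrixP=> i j; rewrite !mxE eqSS !ord1 eqxx andbT. Qed.

Lemma cross_basis (k : 'I_n.+1) :
  cross [ffun j => evec F n (lift k j).+1] = (-1) ^+ k *: delta_mx k 0.
Proof.
apply/matrixP=> l j; rewrite !mxE ord1 eqxx andbT.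
have [->|neq_lk] := eqVneq l k.
  rewrite (_ : row' k _ = 1%:M) ?det1 //.
  apply/matrixP=> a b; rewrite !mxE ffunE evecE mxE eqxx andbT.
  by rewrite (inj_eq (@lift_inj _ k)).
have [a def_k _] := unlift_some neq_lk.
rewrite (expand_det_row _ a) big1 ?mulr0 // => b _.
by rewrite !mxE ffunE evecE mxE -def_k (negPf (neq_lift k b)) mul0r.
Qed.

Lemma form_op_basis M (k : 'I_n.+1) :
  form_op M [ffun j => evec F n (lift k j).+1] = (-1) ^+ k *: col k M.
Proof. by rewrite /form_op cross_basis -scalemxAr -colE. Qed.

Definition form_mx mu : 'M[F]_n.+1 :=
  \matrix_(i < n.+1, k < n.+1)
    ((-1) ^+ k * mu [ffun j => evec F n (lift k j).+1] i 0).

Lemma form_mxK M : form_mx (form_op M) = M.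
Proof.
by apply/matrixP=> i k; rewrite mxE form_op_basis !mxE signrMK.
Qed.

(** The tables of products in the definitions omit the signs of the minors,
which is why column k of the matrix carries the factor (-1)^k. *)
Lemma alt_opE c :
  alt_op c =1 form_op (\matrix_(i, k) ((-1) ^+ k * c k.+1 i 0)).
Proof.
move=> x; apply/matrixP=> i j; rewrite ord1 summxE mxE; apply: eq_bigr => k _.
by rewrite !mxE mulrACA -expr2 sqrr_sign mul1r mulrC.
Qed.

End CrossProduct.

(** * Anticommutative products are determined by their matrix *)

Section Expansion.

Variables (F : fieldType) (n : nat).

Local Notation V := 'cV[F]_n.+1.
Implicit Types (x y : {ffun 'I_n -> V}) (z v : V) (mu lam : nary_op F n).

Lemma linear_sumZ (U W : lmodType F) (I : finType) (f : U -> W) (a : I -> F)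
    (u : I -> U) :
  linear f -> f (\sum_i a i *: u i) = \sum_i a i *: f (u i).
Proof.
move=> lin_f; have f0 : f 0 = 0.
  by have := lin_f (-1) 0 0; rewrite scaler0 addr0 scaleN1r addNr.
elim: (index_enum I) => [|i s IHs]; first by rewrite !big_nil.
by rewrite !big_cons lin_f IHs.
Qed.

Lemma cV_sum_delta v : v = \sum_k v k 0 *: delta_mx k 0.
Proof.
by rewrite {1}[v]matrix_sum_delta; apply: eq_bigr => k _; rewrite big_ord1.
Qed.

(** The arguments are expanded on the basis one at a time; the induction is on
the number of leading arguments that are not yet basis vectors. *)
Lemma multilinear_eq mu lam : multilinear mu -> multilinear lam ->
  (forall s : {ffun 'I_n -> 'I_n.+1},
     mu [ffun i => evec F n (s i).+1] = lam [ffun i => evec F n (s i).+1]) ->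
  mu =1 lam.
Proof.
move=> lin_mu lin_lam eq_basis x.
suff eq_from m y : (m <= n)%N ->
    (forall i : 'I_n, (m <= i)%N -> exists k : 'I_n.+1, y i = evec F n k.+1) ->
  mu y = lam y.
  by apply: (eq_from n) => // i; rewrite leqNgt ltn_ord.
elim: m y {x} => [|m IHm] x ltmn basic_x.
  have [s def_x] := fin_all_exists (fun i => basic_x i isT).
  have -> : x = [ffun i => evec F n ((finfun s) i).+1]; last exact: eq_basis.
  by apply/ffunP=> i; rewrite !ffunE.
pose i0 := Ordinal ltmn.
have -> : x = put x i0 (\sum_k x i0 k 0 *: delta_mx k 0).
  rewrite -cV_sum_delta; apply/ffunP=> j; rewrite ffunE.
  by case: eqP => // /val_inj->.
rewrite (linear_sumZ _ _ (lin_mu x i0)) (linear_sumZ _ _ (lin_lam x i0)).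
apply: eq_bigr => k _; congr (_ *: _); apply: IHm => [|j le_mj].
  exact: ltnW.
rewrite ffunE; case: eqP => [_|/eqP neq_jm]; first by exists k; rewrite evecE.
by apply: basic_x; rewrite ltn_neqAle eq_sym neq_jm.
Qed.

Lemma anticommutative_repeat mu x (i j : 'I_n) : (2 != 0 :> F) ->
  anticommutative mu -> i != j -> x i = x j -> mu x = 0.
Proof.
move=> nz2 anti_mu neq_ij eq_x; have := anti_mu (tperm i j) x.
have -> : [ffun k => x (tperm i j k)] = x.
  by apply/ffunP=> k; rewrite ffunE; case: tpermP => // ->.
rewrite odd_tperm neq_ij expr1 scaleN1r => /eqP.
rewrite -subr_eq0 opprK -mulr2n -scaler_nat scaler_eq0 (negPf nz2).
by move/eqP.
Qed.

(** On a tuple of basis vectors with a repetition both products vanish. A tuple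
without repetition misses exactly one index k, so it is a permutation of the
increasing tuple that omits k, on which the two products agree. *)
Lemma form_mx_eq mu lam : (2 != 0 :> F) ->
  multilinear mu -> multilinear lam -> anticommutative mu ->
  anticommutative lam -> form_mx mu = form_mx lam -> mu =1 lam.
Proof.
move=> nz2 lin_mu lin_lam anti_mu anti_lam eq_mx; apply: multilinear_eq => // s.
have [inj_s|/injectivePn[i [j neq_ij eq_s]]] := boolP (injectiveb s);
  last first.
  by rewrite !(anticommutative_repeat _ _ neq_ij) // !ffunE eq_s.
have /card_gt0P[k k'im] : (0 < #|[predC codom s]|)%N.
  rewrite -(ltn_add2l #|codom s|) cardC addn0 card_ord.
  by rewrite (card_codom (injectiveP _ inj_s)) card_ord.
have /fin_all_exists[t def_s] i : exists j, s i = lift k j.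
  case: (unliftP k (s i)) => [j ->|s_i]; first by exists j.
  by case/negP: k'im; rewrite -s_i codom_f.
have inj_t : injective t.
  by move=> i j eq_t; apply: (injectiveP _ inj_s); rewrite !def_s eq_t.
pose b := [ffun j => evec F n (lift k j).+1] : {ffun 'I_n -> V}.
have -> : [ffun i => evec F n (s i).+1] = [ffun i => b (perm inj_t i)].
  by apply/ffunP=> i; rewrite !ffunE permE def_s.
have eq_b : mu b = lam b.
  apply/matrixP=> i j; move/matrixP/(_ i k): eq_mx.
  by rewrite !mxE ord1 => /(can_inj (signrMK _)).
have: (-1) ^+ perm inj_t *: mu b = (-1) ^+ perm inj_t *: lam b by rewrite eq_b.
rewrite (anti_mu (perm inj_t)) (anti_lam (perm inj_t)) !scalerA.
by rewrite -expr2 sqrr_sign !scale1r.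
Qed.

Lemma form_opK mu : (2 != 0 :> F) ->
  multilinear mu -> anticommutative mu -> mu =1 form_op (form_mx mu).
Proof.
move=> nz2 lin_mu anti_mu; apply: form_mx_eq => //.
- exact: form_op_multilinear.
- exact: form_op_anticommutative.
by rewrite form_mxK.
Qed.

End Expansion.

(** * The Filippov identity in terms of the matrix *)

Section FilippovForm.

Variables (F : fieldType) (p : nat).
Local Notation n := p.+1.
Local Notation V := 'cV[F]_n.+1.
Implicit Types (x y : {ffun 'I_n -> V}) (z v : V) (M g : 'M[F]_n.+1).

(** The skew form z, z' |-> det [z' | z, y_2, ..., y_n]. In these terms the
operator z |-> [z, y_2, ..., y_n] is M *m wedge_mx y. *)
Definition wedge_mx y : 'M[F]_n.+1 :=
  \matrix_(i, j) cross (put y 0 (delta_mx j 0)) i 0.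

Lemma cross_wedge y z : cross (put y 0 z) = wedge_mx y *m z.
Proof.
rewrite {1}[z]cV_sum_delta.
rewrite (linear_sumZ _ _ (@cross_put_linear _ _ y ord0)).
apply/matrixP=> i j; rewrite ord1 summxE mxE; apply: eq_bigr => k _.
by rewrite mxE [X in _ = X * _]mxE mulrC.
Qed.

Lemma wedge_mx_det y i j :
  wedge_mx y i j = \det (bordered (delta_mx i 0) (put y 0 (delta_mx j 0))).
Proof.
have := cross_det (delta_mx i 0) (put y 0 (delta_mx j 0)).
rewrite trmx_delta -rowE => /(congr1 (fun A : 'M_1 => A 0 0)).
rewrite [wedge_mx _ _ _]mxE.
by rewrite [LHS]mxE [RHS]mxE mulr1n.
Qed.

Lemma bordered_swap y z v :
  bordered v (put y 0 z) = xcol 0 (lift 0 0) (bordered z (put y 0 v)).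
Proof.
apply/matrixP=> a b; rewrite [RHS]mxE;
  case: (unliftP 0 b) => [c|] ->; last first.
  by rewrite tpermL bordered0 borderedS ffunE.
case: (unliftP 0 c) => [d|] ->.
  by rewrite tpermD ?borderedS ?ffunE // (inj_eq (@lift_inj _ 0)).
by rewrite tpermR bordered0 borderedS ffunE.
Qed.

Lemma wedge_mx_tr y : (wedge_mx y)^T = - wedge_mx y.
Proof.
apply/matrixP=> i j; rewrite mxE [RHS]mxE !wedge_mx_det bordered_swap.
rewrite xcolE det_mulmx det_perm odd_tperm /=.
by rewrite mulrN1.
Qed.

(** The infinitesimal version of [cross_act]. Paired with z, the sum is the
derivative of det [z | x] along g, computed by [sum_det_setcol], minus the term
in which g acts on z. *)
Lemma sum_cross_put g x :
  \sum_(i < n) cross (put x i (g *m x i)) = ((\tr g)%:M - g^T) *m cross x.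
Proof.
apply: eq_dual => z; rewrite mulmx_sumr.
under eq_bigr do rewrite cross_det bordered_put.
rewrite mulmxA mulmxBr mul_mx_scalar -trmx_mul mulmxBl -scalemxAl.
rewrite !cross_det scale_scalar_mx -sum_det_setcol [in RHS]big_ord_recl.
have -> : col ord0 (bordered z x) = z.
  by apply/matrixP=> i j; rewrite mxE ord1 bordered0.
rewrite -(bordered_setcol0 (g *m z) z) -(raddf_sum (@scalar_mx F 1)) -raddfB.
rewrite addrC addrA addNr add0r; congr _%:M; apply: eq_bigr => i _.
congr (\det (setcol _ _ (_ *m _))).
by apply/matrixP=> a b; rewrite [RHS]mxE borderedS ord1.
Qed.

(** Both sides of the identity have the form N w(x) for some matrix N, by
[cross_wedge] and [sum_cross_put], and the vectors w(x) span the space. *)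
Lemma filippov_identity_form M :
  filippov_identity (form_op M) <->
  forall y, let W := wedge_mx y in
    M *m W *m (M - M^T) = \tr (M *m W) *: M.
Proof.
have lhsE x y : form_op M (put y 0 (form_op M x)) =
    M *m wedge_mx y *m M *m cross x.
  by rewrite /form_op cross_wedge !mulmxA.
have rhsE x y : \sum_(i < n) form_op M (put x i (form_op M (put y 0 (x i)))) =
    (\tr (M *m wedge_mx y) *: M + M *m wedge_mx y *m M^T) *m cross x.
  rewrite /form_op -mulmx_sumr.
  under eq_bigr do rewrite cross_wedge mulmxA.
  rewrite sum_cross_put mulmxA mulmxBr mul_mx_scalar trmx_mul wedge_mx_tr.
  by rewrite mulNmx mulmxN opprK mulmxA.
split=> [idM y W|idM x y].
  apply/eqP; rewrite mulmxBr subr_eq; apply/eqP/matrixP=> i k.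
  have := idM [ffun j => evec F n (lift k j).+1] y.
  rewrite lhsE rhsE cross_basis -!scalemxAr -!colE => /matrixP/(_ i 0).
  have colP (A : 'M[F]_n.+1) : ((-1) ^+ k *: col k A) i 0 = (-1) ^+ k * A i k.
    by rewrite !mxE.
  by rewrite !colP => /(can_inj (signrMK _)).
rewrite lhsE rhsE; congr (_ *m _); apply/eqP.
by rewrite -subr_eq -mulmxBr idM.
Qed.

Lemma det_mx22 (R : comNzRingType) (A : 'M[R]_2) :
  \det A = A 0 0 * A 1 1 - A 0 1 * A 1 0.
Proof.
have lift01 (i : 'I_1) : lift 0 i = 1 :> 'I_2 by rewrite ord1; apply/eqP.
have lift10 (i : 'I_1) : lift 1 i = 0 :> 'I_2 by rewrite ord1; apply/eqP.
rewrite (expand_det_row _ 0) !big_ord_recl big_ord0 /cofactor !det_mx11 !mxE.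
by rewrite !lift01 lift10 addr0 expr0 mul1r expr1 mulN1r mulrN.
Qed.

(** Take for y_2, ..., y_n the basis vectors other than e_a and e_b: then the
determinant is, up to sign, the minor of [z' | z] on the rows a and b. *)
Lemma wedge_mx_delta (a b : 'I_n.+1) : a != b ->
  exists e : bool, exists y,
    wedge_mx y = (-1) ^+ e *: (delta_mx a b - delta_mx b a).
Proof.
move=> neq_ab; pose b' := tperm 0 a b.
have nz_b' : b' != 0.
  by rewrite -(inj_eq (@perm_inj _ (tperm 0 a))) tpermK tpermL eq_sym.
(* A permutation sending 0 to a and 1 to b. *)
pose s := (tperm (lift 0 0) b' * tperm 0 a)%g.
have s0 : s 0 = a by rewrite permM tpermD ?tpermL.
have s1 : s (lift 0 0) = b by rewrite permM tpermL tpermK.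
exists s, [ffun j => evec F n (s (lift 0 j)).+1].
apply/matrixP=> i j; rewrite wedge_mx_det; set X := bordered _ _.
(* After this row permutation the columns of y become unit columns, and the
   determinant is that of the upper left 2 x 2 block. *)
have [Y defY] : exists Y : 'M[F]_(2 + p), Y = row_perm s X.
  by exists (row_perm s X).
have detY : \det Y = (-1) ^+ s * \det X.
  by rewrite defY row_permE det_mulmx det_perm.
have Y0 c : Y c 0 = (s c == i)%:R.
  by rewrite defY mxE bordered0 mxE andbT.
have Y1 c : Y c (lift 0 0) = (s c == j)%:R.
  by rewrite defY mxE borderedS ffunE mxE andbT.
have Y2 c (d : 'I_p) : Y c (lift 0 (lift 0 d)) = (c == lift 0 (lift 0 d))%:R.
  by rewrite defY mxE borderedS !ffunE /= evecE mxE andbT (inj_eq perm_inj).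
have shift0 : lshift p 0 = 0 :> 'I_(2 + p) by apply/val_inj.
have shift1 : lshift p 1 = lift 0 0 :> 'I_(2 + p) by apply/val_inj.
have shift2 d : rshift 2 d = lift 0 (lift 0 d) :> 'I_(2 + p) by apply/val_inj.
have: \det Y = (a == i)%:R * (b == j)%:R - (a == j)%:R * (b == i)%:R.
  rewrite -(submxK Y).
  have -> : ursubmx Y = 0.
    apply/matrixP=> c d; rewrite !mxE shift2 Y2.
    by case: eqP => // /(congr1 val) /= eq_cd; have := ltn_ord c; rewrite eq_cd.
  have -> : drsubmx Y = 1%:M.
    apply/matrixP=> c d; rewrite !mxE !shift2 Y2.
    by rewrite -!shift2 (inj_eq (@rshift_inj _ _)).
  rewrite det_lblock det1 mulr1 det_mx22.
  by rewrite !mxE shift0 shift1 !Y0 !Y1 s0 s1.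
rewrite detY => /(congr1 ( *%R ((-1) ^+ s))); rewrite signrMK => ->.
rewrite !mxE -!natrM !mulnb; congr (_ * (_%:R - _%:R)).
  by rewrite (eq_sym i) (eq_sym j).
by rewrite (eq_sym i) (eq_sym j) andbC.
Qed.

End FilippovForm.

(** * Congruence and the dichotomy for Filippov matrices *)

Section FilippovCondition.

Variable F : fieldType.

(** The Filippov identity with W ranging over all skew matrices. In this form
it is visibly invariant under congruence. *)
Definition filippov_mx N (M : 'M[F]_N) :=
  forall W : 'M[F]_N, W^T = - W -> M *m W *m (M - M^T) = \tr (M *m W) *: M.

Lemma filippov_mx_identity p (M : 'M[F]_p.+2) :
  filippov_mx M -> filippov_identity (form_op M).
Proof.
by move=> filM; apply/filippov_identity_form=> y; apply/filM/wedge_mx_tr.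
Qed.

Lemma mulmx_delta_entry N (M A : 'M[F]_N) a b i j :
  (M *m delta_mx a b *m A) i j = M i a * A b j.
Proof.
rewrite -(mul_delta_mx (0 : 'I_1)) -mulmxA -mulmxA mulmxA -colE -rowE mxE.
by rewrite big_ord1 !mxE.
Qed.

Lemma mxtrace_mul_delta N (M : 'M[F]_N) a b : \tr (M *m delta_mx a b) = M b a.
Proof.
rewrite -(mul_delta_mx (0 : 'I_1)) mulmxA -colE mxtrace_mulC -rowE.
by rewrite /mxtrace big_ord1 !mxE.
Qed.

(** The coordinates of the wedge product of row i of M with the 2-form A. They
are the entries of the condition for W = E_ab - E_ba. *)
Lemma filippov_cyclic p (M : 'M[F]_p.+2) :
  filippov_identity (form_op M) -> forall a b i j, let A := M - M^T in
  M i a * A b j + M i b * A j a + M i j * A a b = 0.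
Proof.
move=> /filippov_identity_form idM a b i j A.
have A_E k l : A k l = M k l - M l k by rewrite !mxE.
have [<-|neq_ab] := eqVneq a b; first by rewrite !A_E; ring.
have [e [y def_W]] := wedge_mx_delta F neq_ab.
have trE : \tr (M *m (delta_mx a b - delta_mx b a)) = M b a - M a b.
  by rewrite mulmxBr raddfB /= !mxtrace_mul_delta.
have := idM y; rewrite /= def_W -scalemxAr -scalemxAl mxtraceZ -scalerA trE -/A.
move=> /(scalerI (_ : (-1) ^+ e != 0)); rewrite signr_eq0 => /(_ isT).
rewrite [M *m (_ - delta_mx _ _)]mulmxBr mulmxBl => /matrixP/(_ i j).
rewrite [LHS]mxE [RHS]mxE.
rewrite [X in _ + X]mxE !mulmx_delta_entry A_E => /eqP.
rewrite -subr_eq0 => /eqP <-.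
by rewrite !A_E; ring.
Qed.

Definition congr_mx N (M L : 'M[F]_N) :=
  exists2 h : 'M[F]_N, h \in unitmx & L = h *m M *m h^T.

Lemma congr_mx_refl N (M : 'M[F]_N) : congr_mx M M.
Proof. by exists 1%:M; rewrite ?unitmx1 // trmx1 mul1mx mulmx1. Qed.

Lemma congr_mx_sym N (M L : 'M[F]_N) : congr_mx M L -> congr_mx L M.
Proof.
case=> h h_unit ->; exists (invmx h); first by rewrite unitmx_inv.
by rewrite -!mulmxA -trmx_mul mulVmx // trmx1 mulmx1 mulKmx.
Qed.

Lemma congr_mx_trans N (M L K : 'M[F]_N) :
  congr_mx M L -> congr_mx L K -> congr_mx M K.
Proof.
case=> h h_unit ->{L} [g g_unit ->]; exists (g *m h).
  by rewrite unitmx_mul g_unit.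
by rewrite trmx_mul !mulmxA.
Qed.

Lemma congr_mx_symmetric N (M L : 'M[F]_N) :
  congr_mx M L -> M^T = M -> L^T = L.
Proof. by case=> h _ -> symM; rewrite !trmx_mul trmxK symM mulmxA. Qed.

Lemma filippov_mx_congr N (M L : 'M[F]_N) :
  congr_mx M L -> filippov_mx M -> filippov_mx L.
Proof.
case=> h _ -> filM W antiW.
pose V := h^T *m W *m h.
have antiV : V^T = - V by rewrite !trmx_mul trmxK antiW mulNmx mulmxN mulmxA.
have -> : h *m M *m h^T - (h *m M *m h^T)^T = h *m (M - M^T) *m h^T.
  by rewrite !trmx_mul trmxK mulmxBr mulmxBl !mulmxA.
have -> : \tr (h *m M *m h^T *m W) = \tr (M *m V).
  by rewrite -!mulmxA mxtrace_mulC !mulmxA.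
by rewrite scalemxAl scalemxAr -filM // !mulmxA.
Qed.

(** Independent rows can be completed to a basis; Gaussian elimination provides
the completion. *)
Lemma row_free_complete k m (Q : 'M[F]_(k, k + m)) :
  row_free Q -> exists2 h : 'M[F]_(k + m), h \in unitmx & usubmx h = Q.
Proof.
move=> /eqP rankQ.
exists (block_mx (col_ebase Q) 0 0 1%:M *m row_ebase Q).
  rewrite unitmx_mul row_ebase_unit andbT unitmxE det_lblock det1 mulr1.
  by rewrite -unitmxE col_ebase_unit.
rewrite -[in RHS](mulmx_ebase Q) rankQ pid_mx_row.
by rewrite -mul_usub_mx block_mxEv col_mxKu mul_mx_row mulmx1 mulmx0.
Qed.

Definition corner_mx m (B : 'M[F]_2) : 'M[F]_(2 + m) := block_mx B 0 0 0.

Lemma corner_mx_congr m (B C : 'M[F]_2) :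
  congr_mx B C -> congr_mx (corner_mx m B) (corner_mx m C).
Proof.
case=> h h_unit ->; exists (block_mx h 0 0 1%:M).
  by rewrite unitmxE det_lblock det1 mulr1 -unitmxE.
rewrite tr_block_mx trmx1 !trmx0 !mulmx_block.
by rewrite !(mulmx0, mul0mx, mul1mx, mulmx1, addr0, add0r).
Qed.

(** If A_ab is not zero, then the hypothesis makes every row of M, and its
antisymmetrization makes every row of A, a combination of rows a and b of A.
Gathering these two rows in Q, with right inverse P, this says that M P Q = M
and A P Q = A, hence M^T P Q = M^T; so M = Q^T (P^T M P) Q. *)
Lemma corner_mxP m (M : 'M[F]_(2 + m)) :
    (2 != 0 :> F) ->
    (forall a b i j, let A := M - M^T in
       M i a * A b j + M i b * A j a + M i j * A a b = 0) ->
  M^T = M \/ exists2 B : 'M[F]_2, B^T != B & congr_mx (corner_mx m B) M.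
Proof.
move=> nz2 cycM; have [/eqP symM|asymM] := boolP (M^T == M); [by left | right].
pose A := M - M^T; have A_E k l : A k l = M k l - M l k by rewrite !mxE.
have defMt : M^T = M - A by rewrite /A subKr.
have {}cycM a b i j : M i a * A b j + M i b * A j a + M i j * A a b = 0.
  exact: cycM.
clearbody A.
have /existsP[a /existsP[b nzA]] : [exists a, exists b, A a b != 0].
  apply: contraNT asymM => /existsPn A0; apply/eqP/matrixP=> i j.
  have /existsPn/(_ j) := A0 i; rewrite negbK A_E subr_eq0 => /eqP->.
  by rewrite mxE.
have cycA i j : A i a * A b j + A i b * A j a + A i j * A a b = 0.
  apply: (mulfI nz2); rewrite mulr0.
  pose T x p q y := M x p * A q y + M x q * A y p + M x y * A p q.
  have T0 x p q y : T x p q y = 0 by apply: cycM.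
  (* The alternating sum over the four indices: M only enters through A. *)
  transitivity (T i a b j - T a b j i + T b j i a - T j i a b).
    by rewrite /T !A_E; ring.
  by rewrite !T0 !(subr0, addr0).
pose Q : 'M[F]_(2, 2 + m) := \matrix_(i, j) A (if i == 0 then a else b) j.
(* On e_a and e_b the rows of Q are (0, A_ab) and (-A_ab, 0);
   P inverts this block. *)
pose P : 'M[F]_(2 + m, 2) := (A a b)^-1 *:
  \matrix_(i, j) if j == 0 then (i == b)%:R else - (i == a)%:R.
have mulP k (B : 'M[F]_(k, 2 + m)) i j :
    (B *m P) i j = (A a b)^-1 * (if j == 0 then B i b else - B i a).
  rewrite -scalemxAr mxE; congr (_ * _); rewrite mxE.
  rewrite (bigD1 (if j == 0 then b else a)) //= big1 => [|l neq_l].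
    by rewrite addr0 mxE; case: ifP => _; rewrite eqxx ?mulrN1 ?mulr1.
  rewrite mxE; case: ifP neq_l => _ /negPf->; by rewrite ?oppr0 mulr0.
have mulPQ (B : 'M[F]_(2 + m)) i j :
    (B *m P *m Q) i j = (A a b)^-1 * (B i b * A a j - B i a * A b j).
  rewrite mxE !big_ord_recl big_ord0 addr0 !mulP !mxE /=.
  by ring.
have M_PQ : M *m P *m Q = M.
  apply/matrixP=> i j; rewrite mulPQ; apply: (mulfI nzA).
  rewrite mulVKf //; apply/eqP; rewrite -subr_eq0 -oppr_eq0 -(cycM a b i j).
  by rewrite !A_E; apply/eqP; ring.
have A_PQ : A *m P *m Q = A.
  apply/matrixP=> i j; rewrite mulPQ; apply: (mulfI nzA).
  rewrite mulVKf //; apply/eqP; rewrite -subr_eq0 -oppr_eq0 -(cycA i j).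
  by rewrite !A_E; apply/eqP; ring.
have Mt_PQ : M^T *m P *m Q = M^T.
  by rewrite defMt !mulmxBl M_PQ A_PQ.
have defM : M = Q^T *m (P^T *m M *m P) *m Q.
  rewrite -{1}M_PQ -{1}[M]trmxK -Mt_PQ !trmx_mul trmxK.
  by rewrite !mulmxA.
have QP : Q *m P = 1%:M.
  have Akk k : A k k = 0 by rewrite A_E subrr.
  have Aba : - A b a = A a b by rewrite !A_E opprB.
  apply/matrixP=> i j; rewrite mulP [RHS]mxE ![Q _ _]mxE.
  case: (unliftP 0 i) => [k|] ->; case: (unliftP 0 j) => [l|] -> /=.
  - by rewrite !ord1 eqxx Aba mulVf.
  - by rewrite Akk mulr0.
  - by rewrite Akk oppr0 mulr0.
  by rewrite mulVf.
have freeQ : row_free Q by apply/row_freeP; exists P.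
have [h h_unit def_Q] := row_free_complete freeQ.
have congM : congr_mx (corner_mx m (P^T *m M *m P)) M.
  exists h^T; rewrite ?unitmx_tr // trmxK.
  have -> : h = col_mx Q (dsubmx h) by rewrite -def_Q vsubmxK.
  rewrite tr_col_mx mul_row_block mul_row_col.
  by rewrite !mulmx0 !addr0 mul0mx addr0.
exists (P^T *m M *m P) => //; apply: contraNneq asymM => symB; apply/eqP.
by rewrite [in LHS]defM 2!trmx_mul trmxK symB mulmxA -defM.
Qed.

End FilippovCondition.

(** * Normal forms under congruence *)

Section NormalForms.

Variable F : numClosedFieldType.

Lemma two_neq0 : 2 != 0 :> F.
Proof. by rewrite pnatr_eq0. Qed.

(** A nonzero symmetric form does not vanish on all of e_i and e_i + e_j, since
2 is invertible; a square root normalizes its value. *)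
Lemma symmetric_anisotropic N (M : 'M[F]_N) : M^T = M -> M != 0 ->
  exists v : 'rV[F]_N, v *m M *m v^T = 1%:M.
Proof.
move=> symM nzM.
suff [v nz_v] : exists v : 'rV[F]_N, (v *m M *m v^T) 0 0 != 0.
  exists ((sqrtC ((v *m M *m v^T) 0 0))^-1 *: v).
  rewrite linearZ /= -!scalemxAl -scalemxAr scalerA -invfM -expr2 sqrtCK.
  by rewrite {2}[v *m M *m v^T]mx11_scalar scale_scalar_mx mulVf.
have formE i j : (delta_mx 0 i : 'rV[F]_N) *m M *m (delta_mx 0 j : 'rV[F]_N)^T
    = (M i j)%:M.
  by rewrite trmx_delta -rowE -colE; apply/matrixP=> k l; rewrite !ord1 !mxE.
have [/forallP diag0|/forallPn[i nz_i]] := boolP [forall i, M i i == 0];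
  last first.
  by exists (delta_mx 0 i); rewrite formE mxE.
have /existsP[i /existsP[j nz_ij]] : [exists i, exists j, M i j != 0].
  apply: contraNT nzM => /existsPn M0; apply/eqP/matrixP=> i j.
  by have /existsPn/(_ j) := M0 i; rewrite negbK mxE => /eqP.
exists (delta_mx 0 i + delta_mx 0 j).
rewrite linearD /= !mulmxDl !mulmxDr !formE (eqP (diag0 i)) (eqP (diag0 j)).
rewrite -(_ : M i j = M j i); last by rewrite -{1}symM mxE.
by rewrite raddf0 add0r addr0 !mxE eqxx !mulr1n -mulr2n -mulr_natr
  mulf_neq0 ?two_neq0.
Qed.

(** Completing the square: a vector of value 1 is taken as first basis vector,
and its row and column are cleared by one elimination step. *)
Lemma symmetric_congr_pid N (M : 'M[F]_N) : M^T = M ->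
  exists2 r, (r <= N)%N & congr_mx (pid_mx r) M.
Proof.
elim: N M => [|N IHN] M symM.
  by exists 0%N => //; rewrite [M]flatmx0 [pid_mx _]flatmx0;
    apply: congr_mx_refl.
have [->|nzM] := eqVneq M 0.
  by exists 0%N => //; rewrite pid_mx_0; apply: congr_mx_refl.
have [v v1] := symmetric_anisotropic symM nzM.
have free_v : row_free v.
  rewrite /row_free rank_rV; suff -> : v != 0 by [].
  apply: contraNneq (oner_neq0 F) => v0; have /matrixP/(_ 0 0) := v1.
  by rewrite v0 !mul0mx !mxE eqxx => /eqP; rewrite eq_sym.
have [h h_unit def_v] := @row_free_complete _ 1 N v free_v.
pose L : 'M[F]_(1 + N) := h *m M *m h^T.
have symL : L^T = L by apply: congr_mx_symmetric symM; exists h.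
have L11 : ulsubmx L = 1%:M.
  have defh : h = col_mx v (dsubmx h) by rewrite -def_v vsubmxK.
  by rewrite /L defh tr_col_mx mul_col_mx mul_col_row block_mxKul.
pose b := ursubmx L; pose D := drsubmx L - b^T *m b.
have symD : D^T = D.
  rewrite /D raddfB /= trmx_mul trmxK; congr (_ - _).
  by rewrite trmx_drsub symL.
have [r le_rN [k k_unit def_D]] := IHN D symD.
exists r.+1 => //.
have congL : congr_mx M L by exists h.
apply: congr_mx_trans (congr_mx_sym congL).
(* E clears the first row and column; D is the Schur complement. *)
pose E : 'M[F]_(1 + N) := block_mx 1%:M 0 b^T 1%:M.
rewrite -[N.+1]/(1 + N)%N; exists (E *m block_mx 1%:M 0 0 k).
  rewrite unitmx_mul !unitmxE /E !det_lblock !det1 !mul1r unitr1 /=.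
  by rewrite -unitmxE.
have -> : pid_mx r.+1 = block_mx 1%:M 0 0 (pid_mx r) :> 'M[F]_(1 + N).
  apply/matrixP=> i j; rewrite [LHS]mxE [RHS]mxE.
  case: splitP => i' def_i; rewrite [RHS]mxE; case: splitP => j' def_j;
    by rewrite mxE ?ord1 def_i def_j ?ord1.
rewrite trmx_mul !tr_block_mx trmxK !trmx1 !trmx0 !mulmxA.
rewrite !mulmx_block !(mulmx0, mul0mx, mul1mx, mulmx1, addr0, add0r).
rewrite -def_D -[LHS]submxK L11 -/b addrC subrK; congr block_mx.
by rewrite /b trmx_ursub symL.
Qed.

Definition mx2 (a b c d : F) : 'M[F]_2 :=
  \matrix_(i, j) if i == 0 then (if j == 0 then a else b)
                 else (if j == 0 then c else d).

Lemma mx2_eta (B : 'M[F]_2) : B = mx2 (B 0 0) (B 0 1) (B 1 0) (B 1 1).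
Proof.
have ord2 (i : 'I_2) : i = if i == 0 then 0 else 1.
  by apply/eqP; case: i => [[|[]]].
apply/matrixP=> i j; rewrite mxE {1}(ord2 i) {1}(ord2 j).
by case: eqP => _; case: eqP.
Qed.

Lemma tr_mx2 a b c d : (mx2 a b c d)^T = mx2 a c b d.
Proof. by rewrite [LHS]mx2_eta !mxE. Qed.

Lemma mul_mx2 a b c d a' b' c' d' :
  mx2 a b c d *m mx2 a' b' c' d' =
  mx2 (a * a' + b * c') (a * b' + b * d') (c * a' + d * c') (c * b' + d * d').
Proof.
by rewrite [LHS]mx2_eta !mxE !big_ord_recl !big_ord0 !mxE /= !addr0.
Qed.

Lemma unit_mx2 a b c d : (mx2 a b c d \in unitmx) = (a * d - b * c != 0).
Proof. by rewrite unitmxE det_mx22 !mxE /= unitfE. Qed.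

(** The rows of the change of basis are (x, y) and (z, t). *)
Lemma mx2_congr a b c d a' b' c' d' x y z t : x * t - y * z != 0 ->
    a' = x * (x * a + y * c) + y * (x * b + y * d) ->
    b' = z * (x * a + y * c) + t * (x * b + y * d) ->
    c' = x * (z * a + t * c) + y * (z * b + t * d) ->
    d' = z * (z * a + t * c) + t * (z * b + t * d) ->
  congr_mx (mx2 a b c d) (mx2 a' b' c' d').
Proof.
move=> nz_det -> -> -> ->; exists (mx2 x y z t); first by rewrite unit_mx2.
by rewrite tr_mx2 !mul_mx2; congr mx2; ring.
Qed.

Lemma corner_mx2E m a b c d (i j : 'I_(2 + m)) :
  corner_mx m (mx2 a b c d) i j =
    match nat_of_ord i, nat_of_ord j with
    | 0, 0 => a | 0, 1 => b | 1, 0 => c | 1, 1 => d | _, _ => 0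
    end.
Proof.
rewrite /corner_mx; case: (split_ordP i) => i' ->;
  case: (split_ordP j) => j' ->.
- rewrite block_mxEul mxE.
  by case: i' => [[|[|//]] ?]; case: j' => [[|[|//]] ?].
- by rewrite block_mxEur mxE; case: i' => [[|[|//]] ?].
- by rewrite block_mxEdl mxE.
by rewrite block_mxEdr mxE.
Qed.

Definition mx_C2 a := mx2 a 0 1 (-1).
Definition mx_C3 := mx2 0 (-1) 1 0.

(** If the quadratic form of B is not zero, then some f_2 has value -1. The
vectors u with B(u, f_2) = 0 form a line, on which B(f_2, u) is not zero
because B is not symmetric; f_1 is chosen there with B(f_2, f_1) = 1. In the
basis f_1, f_2 the form is [mx_C2 a] with a = B(f_1, f_1). If the quadratic
form of B is zero, then B is alternating, and a rescaling gives [mx_C3]. *)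
Lemma asymmetric_mx2 (B : 'M[F]_2) : B^T != B ->
  congr_mx B mx_C3 \/ exists a, congr_mx B (mx_C2 a).
Proof.
rewrite [B]mx2_eta; move: (B 0 0) (B 0 1) (B 1 0) (B 1 1) => a b c d {B}.
rewrite tr_mx2 => asym.
have neq_bc : b - c != 0.
  by apply: contraNneq asym => /eqP; rewrite subr_eq0 => /eqP->.
pose q x y := x * (a * x + b * y) + y * (c * x + d * y).
suff: (forall x y, q x y = 0) \/ exists x y, q x y = -1.
  case=> [q0|[x [y q1]]]; [left | right].
    have a0 : a = 0.
      by have := q0 1 0; rewrite /q !(mulr0, mulr1, addr0, mul1r, mul0r).
    have d0 : d = 0.
      by have := q0 0 1; rewrite /q !(mulr0, mulr1, add0r, mul1r, mul0r).
    have def_c : c = - b.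
      apply/eqP; rewrite -addr_eq0 -(q0 1 1) /q a0 d0; apply/eqP; ring.
    have nzb : b != 0.
      by apply: contraNneq neq_bc => b0; rewrite def_c b0 oppr0 subr0.
    rewrite a0 d0 def_c; apply: (@mx2_congr _ _ _ _ _ _ _ _ (- b^-1) 0 0 1).
    - by rewrite mulr1 mulr0 subr0 oppr_eq0 invr_eq0.
    - by ring.
    - by field.
    - by field.
    - by ring.
  (* f_2 = (x, y), and f_1 spans the kernel of B(-, f_2), scaled by s. *)
  pose s := (c - b)^-1.
  have nz_cb : c - b != 0 by rewrite -opprB oppr_eq0.
  exists (s ^+ 2 *
    ((c * x + d * y) * ((c * x + d * y) * a - (a * x + b * y) * c)
    - (a * x + b * y) * ((c * x + d * y) * b - (a * x + b * y) * d))).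
  apply: (@mx2_congr _ _ _ _ _ _ _ _
    (- s * (c * x + d * y)) (s * (a * x + b * y)) x y).
  - rewrite (_ : _ - _ = - s * q x y); last by rewrite /q; ring.
    by rewrite q1 mulrN1 opprK invr_eq0.
  - by ring.
  - by ring.
  - transitivity ((b - c) * s * q x y); last by rewrite /q; ring.
    by rewrite q1 -opprB mulNr mulfV // mulrN1 opprK.
  - by rewrite -q1 /q; ring.
suff: (forall x y, q x y = 0) \/ exists x y, q x y != 0.
  case=> [|[x [y nz_q]]]; [by left | right].
  exists (x / sqrtC (- q x y)), (y / sqrtC (- q x y)).
  have nz_s : sqrtC (- q x y) != 0 by rewrite sqrtC_eq0 oppr_eq0.
  transitivity (q x y / sqrtC (- q x y) ^+ 2); last first.
    by rewrite sqrtCK invrN mulrN mulfV.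
  by rewrite /q; field.
have [q0|?] := eqVneq (q 1 0) 0; last by right; exists 1, 0.
have [q1|?] := eqVneq (q 0 1) 0; last by right; exists 0, 1.
have [q2|?] := eqVneq (q 1 1) 0; last by right; exists 1, 1.
left=> x y.
(* A binary quadratic form is determined by three of its values. *)
transitivity (q 1 0 * x * (x - y) + q 0 1 * y * (y - x) + q 1 1 * x * y).
  by rewrite /q; ring.
by rewrite q0 q1 q2 !mul0r !addr0.
Qed.

End NormalForms.

(** * Closures of congruence classes *)

Section PolynomialFunctions.

Variables (F : fieldType) (N : nat).
Implicit Types (M L K h : 'M[F]_N) (f g : 'M[F]_N -> F).

(** Polynomials in the entries of a matrix, presented inductively so that
substitutions (congruences, curves, structure constants) need only be checked
on the generators. *)
Inductive poly_fun : ('M[F]_N -> F) -> Prop :=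
| poly_fun_const c : poly_fun (fun=> c)
| poly_fun_entry i j : poly_fun (fun M => M i j)
| poly_fun_add f g of poly_fun f & poly_fun g : poly_fun (fun M => f M + g M)
| poly_fun_mul f g of poly_fun f & poly_fun g : poly_fun (fun M => f M * g M)
| poly_fun_ext f g of f =1 g & poly_fun f : poly_fun g.

Lemma poly_fun_opp f : poly_fun f -> poly_fun (fun M => - f M).
Proof.
move=> poly_f; apply: poly_fun_ext (poly_fun_mul (poly_fun_const (-1)) poly_f).
by move=> M; rewrite mulN1r.
Qed.

Lemma poly_fun_sum I (r : seq I) (P : pred I) (f : I -> 'M[F]_N -> F) :
  (forall i, poly_fun (f i)) -> poly_fun (fun M => \sum_(i <- r | P i) f i M).
Proof.
move=> poly_f; elim: r => [|i r IHr].
  by apply: poly_fun_ext (poly_fun_const 0) => M; rewrite big_nil.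
case Pi: (P i).
  apply: poly_fun_ext (poly_fun_add (poly_f i) IHr) => M.
  by rewrite big_cons Pi.
by apply: poly_fun_ext IHr => M; rewrite big_cons Pi.
Qed.

Lemma poly_fun_prod I (r : seq I) (P : pred I) (f : I -> 'M[F]_N -> F) :
  (forall i, poly_fun (f i)) -> poly_fun (fun M => \prod_(i <- r | P i) f i M).
Proof.
move=> poly_f; elim: r => [|i r IHr].
  by apply: poly_fun_ext (poly_fun_const 1) => M; rewrite big_nil.
case Pi: (P i).
  apply: poly_fun_ext (poly_fun_mul (poly_f i) IHr) => M.
  by rewrite big_cons Pi.
by apply: poly_fun_ext IHr => M; rewrite big_cons Pi.
Qed.

Lemma poly_fun_exp f d : poly_fun f -> poly_fun (fun M => f M ^+ d).
Proof.
move=> poly_f; elim: d => [|d IHd].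
  by apply: poly_fun_ext (poly_fun_const 1) => M; rewrite expr0.
by apply: poly_fun_ext (poly_fun_mul poly_f IHd) => M; rewrite exprS.
Qed.

Lemma poly_fun_mulmx a b (P : 'M[F]_(a, N)) (Q : 'M[F]_(N, b)) i j :
  poly_fun (fun M => (P *m M *m Q) i j).
Proof.
apply: (@poly_fun_ext (fun M => \sum_l (\sum_k P i k * M k l) * Q l j)).
  by move=> M; rewrite mxE; apply: eq_bigr => l _; rewrite mxE.
apply: poly_fun_sum => l; apply: poly_fun_mul (poly_fun_const _).
apply: poly_fun_sum => k.
exact: poly_fun_mul (poly_fun_const _) (poly_fun_entry _ _).
Qed.

Lemma poly_fun_det a (P : 'M[F]_(a, N)) (Q : 'M[F]_(N, a)) :
  poly_fun (fun M => \det (P *m M *m Q)).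
Proof.
apply: poly_fun_sum => s; apply: poly_fun_mul (poly_fun_const _) _.
by apply: poly_fun_prod => i; apply: poly_fun_mulmx.
Qed.

Lemma poly_fun_congr f h : poly_fun f -> poly_fun (fun M => f (h *m M *m h^T)).
Proof.
elim=> [c|i j|f1 f2 _ ? _ ?|f1 f2 _ ? _ ?|f1 f2 eq_f _ poly_f1].
- exact: poly_fun_const.
- exact: poly_fun_mulmx.
- exact: poly_fun_add.
- exact: poly_fun_mul.
by apply: poly_fun_ext poly_f1 => M; apply: eq_f.
Qed.

Lemma poly_fun_curve f (G : F -> 'M[F]_N) :
    (forall i j, exists q : {poly F}, forall t, G t i j = q.[t]) ->
  poly_fun f -> exists q : {poly F}, forall t, f (G t) = q.[t].
Proof.
move=> polyG;
  elim=> [c|i j|f1 f2 _ [q1 Dq1] _ [q2 Dq2]|f1 f2 _ [q1 Dq1] _ [q2 Dq2]|].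
- by exists c%:P => t; rewrite hornerC.
- exact: polyG.
- by exists (q1 + q2) => t; rewrite hornerD Dq1 Dq2.
- by exists (q1 * q2) => t; rewrite hornerM Dq1 Dq2.
by move=> f1 f2 eq_f _ [q Dq]; exists q => t; rewrite -eq_f.
Qed.

(** L is in the Zariski closure of the congruence class of M. *)
Definition congr_closure M L := forall f, poly_fun f ->
  (forall K, congr_mx M K -> f K = 0) -> f L = 0.

(** The group acts by polynomial maps, so the closure of a class is stable. *)
Lemma congr_closure_congr M M' L L' : congr_mx M M' -> congr_mx L L' ->
  congr_closure M L -> congr_closure M' L'.
Proof.
move=> eqM [h h_unit ->] clL f poly_f f0.
apply: (clL _ (poly_fun_congr h poly_f)) => K eqK; apply: f0.
apply: congr_mx_trans (congr_mx_sym eqM) _; apply: congr_mx_trans eqK _.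
by exists h.
Qed.

Lemma congr_closure_refl M : congr_closure M M.
Proof. by move=> f _; apply; apply: congr_mx_refl. Qed.

Lemma congr_closure_symmetric M L : M^T = M -> congr_closure M L -> L^T = L.
Proof.
move=> symM clL; apply/matrixP=> i j; rewrite mxE; apply/eqP; rewrite -subr_eq0.
apply/eqP; apply: (clL (fun K => K j i - K i j)) => [|K congK].
  exact: poly_fun_add (poly_fun_entry _ _) (poly_fun_opp (poly_fun_entry _ _)).
by rewrite -[in X in X - _](congr_mx_symmetric congK symM) mxE subrr.
Qed.

Lemma congr_closure_antisymmetric M L : M^T = - M -> congr_closure M L ->
  L^T = - L.
Proof.
move=> antiM clL; apply/matrixP=> i j; rewrite !mxE.
apply/eqP; rewrite -addr_eq0; apply/eqP.
apply: (clL (fun K => K j i + K i j)) => [|_ [h _ ->]].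
  exact: poly_fun_add (poly_fun_entry _ _) (poly_fun_entry _ _).
have: (h *m M *m h^T)^T = - (h *m M *m h^T).
  by rewrite !trmx_mul trmxK antiM mulNmx mulmxN mulmxA.
by move=> /matrixP/(_ i j); rewrite mxE [RHS]mxE => ->; rewrite addNr.
Qed.

(** The minors det (P K Q) with r rows, where r is the rank of L, vanish on all
K of rank less than r, while one of them takes the value 1 at L. *)
Lemma congr_closure_rank M L : congr_closure M L -> (\rank L <= \rank M)%N.
Proof.
move=> clL; rewrite leqNgt; apply/negP => lt_ML.
pose r := \rank L; pose K := invmx (col_ebase L); pose J := invmx (row_ebase L).
pose P : 'M[F]_(r, N) := pid_mx r *m K; pose Q : 'M[F]_(N, r) := J *m pid_mx r.
have: \det (P *m L *m Q) = 0.
  apply: (clL _ (poly_fun_det P Q)) => _ [h _ ->].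
  apply/eqP; rewrite -[_ == 0]negbK -unitfE -unitmxE -row_free_unit /row_free.
  rewrite neq_ltn (leq_ltn_trans _ lt_ML) //.
  apply: leq_trans (mxrankM_maxl _ _) _; apply: leq_trans (mxrankM_maxr _ _) _.
  by apply: leq_trans (mxrankM_maxl _ _) _; apply: mxrankM_maxr.
rewrite -{1}(mulmx_ebase L) /P /Q !mulmxA mulmxKV ?col_ebase_unit //.
rewrite mulmxK ?row_ebase_unit // !pid_mx_id ?leqnn
  ?rank_leq_row ?rank_leq_col //.
by rewrite pid_mx_1 det1 => /eqP; rewrite oner_eq0.
Qed.

End PolynomialFunctions.

(** * Degenerations along curves *)

Section Curves.

Variable F : numClosedFieldType.

(** The positive integers are infinitely many roots. *)
Lemma horner0_eq0 (q : {poly F}) : (forall t, t != 0 -> q.[t] = 0) -> q.[0] = 0.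
Proof.
move=> q0; have [->|nzq] := eqVneq q 0; first by rewrite horner0.
pose s : seq F := [seq i.+1%:R | i <- iota 0 (size q)].
have: (size s < size q)%N.
  apply: max_poly_roots nzq _ _.
    by apply/allP=> _ /mapP[i _ ->]; rewrite rootE q0 // pnatr_eq0.
  rewrite map_inj_uniq ?iota_uniq // => i j /eqP.
  by rewrite eqr_nat eqSS => /eqP.
by rewrite size_map size_iota ltnn.
Qed.

(** Along a polynomial curve whose points other than t = 0 are all congruent to
M, a polynomial function that vanishes on the class of M also vanishes at t =
0. *)
Lemma congr_closure_curve N (M : 'M[F]_N) (G : F -> 'M[F]_N) :
    (forall i j, exists q : {poly F}, forall t, G t i j = q.[t]) ->
    (forall t, t != 0 -> congr_mx M (G t)) ->
  congr_closure M (G 0).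
Proof.
move=> polyG congG f poly_f f0; have [q Dq] := poly_fun_curve polyG poly_f.
by rewrite Dq; apply: horner0_eq0 => t nzt; rewrite -Dq f0 //; apply: congG.
Qed.

Lemma congr_closure0 N (M : 'M[F]_N) : congr_closure M 0.
Proof.
rewrite -(scale0r M) -[0](expr0n F 2).
apply: (@congr_closure_curve _ _ (fun t => t ^+ 2 *: M)) => [i j|t nzt].
  exists ((M i j)%:P * 'X^2) => t.
  by rewrite mxE hornerM hornerC hornerXn mulrC.
exists t%:M; first by rewrite unitmxE det_scalar unitfE expf_neq0.
by rewrite tr_scalar_mx mul_scalar_mx mul_mx_scalar scalerA.
Qed.

(** The coordinates between s and r are multiplied by t. *)
Lemma congr_closure_pid N r s : (s <= r)%N ->
  congr_closure (pid_mx r : 'M[F]_N) (pid_mx s).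
Proof.
move=> le_sr.
pose d t := \row_(j < N) (if (j < s)%N then 1 else t) : 'rV[F]_N.
pose G t := diag_mx (d t) *m pid_mx r *m (diag_mx (d t))^T.
have GE t i j : G t i j =
    if (i == j) && (i < r)%N then if (i < s)%N then 1 else t ^+ 2 else 0.
  rewrite /G tr_diag_mx mul_diag_mx mul_mx_diag !mxE.
  rewrite -[(i : nat) == j]/(i == j); case: eqP => [<-|_] /=;
    last by rewrite mulr0 mul0r.
  case: (i < r)%N; last by rewrite mulr0 mul0r.
  by case: ifP; rewrite ?mulr1 ?mul1r.
have -> : pid_mx s = G 0.
  apply/matrixP=> i j; rewrite GE mxE -[(i : nat) == j]/(i == j) expr0n /=.
  case: eqP => //= _; case: (ltnP i s) => [lt_is|]; last by case: ifP.
  by rewrite (leq_trans lt_is).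
apply: congr_closure_curve => [i j|t nzt].
  exists (if (i == j) && (i < r)%N
          then if (i < s)%N then 1 else 'X^2 else 0) => t.
  by rewrite GE; case: ifP => _; [case: ifP => _|]; rewrite ?hornerXn ?hornerC.
exists (diag_mx (d t)) => //.
rewrite unitmxE det_diag unitfE; apply/prodf_neq0 => i _; rewrite mxE.
by case: ifP; rewrite ?oner_eq0.
Qed.

Lemma congr_closure_corner m (B : 'M[F]_2) (p q r s : {poly F}) :
    (forall t, t != 0 -> congr_mx B (mx2 p.[t] q.[t] r.[t] s.[t])) ->
  congr_closure (corner_mx m B) (corner_mx m (mx2 p.[0] q.[0] r.[0] s.[0])).
Proof.
move=> congB; pose G t := corner_mx m (mx2 p.[t] q.[t] r.[t] s.[t]).
apply: (@congr_closure_curve _ _ G) => [i j|t nzt]; last first.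
  exact/corner_mx_congr/congB.
exists (match nat_of_ord i, nat_of_ord j with
        | 0, 0 => p | 0, 1 => q | 1, 0 => r | 1, 1 => s | _, _ => 0
        end) => t.
rewrite /G corner_mx2E.
by case: i j => [[|[|i]] ?] [[|[|j]] ?] //=; rewrite horner0.
Qed.

End Curves.

(** * From algebras to matrices *)

Section OperationsAsForms.

Variables (F : numClosedFieldType) (p : nat).
Local Notation n := p.+2.
Implicit Types (mu lam nu : nary_op F n) (M L K g h : 'M[F]_n.+1).

Lemma form_op_act M g x : g \in unitmx ->
  gl_act g (form_op M) x = form_op ((\det g)^-1 *: (g *m M *m g^T)) x.
Proof.
move=> g_unit; rewrite /gl_act /form_op cross_act ?unitmx_inv // invmxK det_inv.
by rewrite -!scalemxAr -scalemxAl !mulmxA.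
Qed.

(** To remove the factor 1 / det g, replace g by c g where c is an (n-1)-th
root of 1 / det g: the determinant grows by c^(n+1) and the congruence by c^2.
In the other direction a square root is enough. *)
Lemma congr_mxP M L : congr_mx M L <->
  exists2 g, g \in unitmx & L = (\det g)^-1 *: (g *m M *m g^T).
Proof.
split=> [] [g g_unit ->].
  have nz_det : \det g != 0 by rewrite -unitfE -unitmxE.
  pose c := p.+1.-root (\det g)^-1.
  have cE : c ^+ p.+1 = (\det g)^-1 by rewrite rootCK.
  have nz_c : c != 0 by rewrite rootC_eq0 ?invr_eq0.
  exists (c *: g); first by rewrite unitmxZ ?unitfE.
  rewrite detZ linearZ /= -!scalemxAl -scalemxAr !scalerA.
  rewrite -[LHS]scale1r; congr (_ *: _).
  rewrite -[p.+3]/(2 + p.+1)%N exprD cE; field.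
  by rewrite nz_c nz_det.
have nz_det : (\det g)^-1 != 0 by rewrite invr_eq0 -unitfE -unitmxE.
exists (sqrtC (\det g)^-1 *: g); first by rewrite unitmxZ ?unitfE ?sqrtC_eq0.
by rewrite linearZ /= -!scalemxAl -scalemxAr scalerA -expr2 sqrtCK.
Qed.

Lemma eq_form_op M L : form_op M =1 form_op L -> M = L.
Proof.
move=> eqML; rewrite -[M]form_mxK -[L]form_mxK.
by apply/matrixP=> i j; rewrite mxE [RHS]mxE eqML.
Qed.

Lemma isomorphic_form mu lam L : isomorphic mu lam -> lam =1 form_op L ->
  exists2 M, mu =1 form_op M & congr_mx M L.
Proof.
move=> [g g_unit g_mor] lamE.
pose K := (\det g) *: (invmx g *m L *m (invmx g)^T).
exists K.
  move=> x; rewrite -[LHS](mulKmx g_unit) g_mor lamE /form_op cross_act //.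
  by rewrite -!scalemxAr -scalemxAl !mulmxA.
apply/congr_mxP; exists g => //.
have nz_det : \det g != 0 by rewrite -unitfE -unitmxE.
rewrite -!scalemxAr -scalemxAl scalerA mulVf // scale1r.
rewrite !mulmxA mulmxV // mul1mx.
by rewrite -mulmxA -trmx_mul mulmxV // trmx1 mulmx1.
Qed.

Lemma isomorphicP mu lam M L : mu =1 form_op M -> lam =1 form_op L ->
  isomorphic mu lam <-> congr_mx M L.
Proof.
move=> muE lamE; split=> [iso|/congr_mxP[g g_unit defL]].
  have [K muE' congK] := isomorphic_form iso lamE.
  by rewrite (@eq_form_op M K) // => x; rewrite -muE.
exists g => // x; rewrite muE lamE defL -form_op_act // /gl_act.
congr (_ *m form_op _ _); apply/ffunP=> i; rewrite !ffunE.
by rewrite mulKmx.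
Qed.

Lemma orbitP mu nu M : mu =1 form_op M ->
  Defs.orbit mu nu <-> exists2 K, congr_mx M K & nu =1 form_op K.
Proof.
move=> muE; split=> [[g g_unit nuE]|[K /congr_mxP[g g_unit ->] nuE]].
  exists ((\det g)^-1 *: (g *m M *m g^T)); first by apply/congr_mxP; exists g.
  by move=> x; rewrite nuE -form_op_act // /gl_act muE.
by exists g => // x; rewrite nuE -form_op_act // /gl_act muE.
Qed.

Lemma multilinear_form mu M : mu =1 form_op M -> multilinear mu.
Proof. by move=> muE x i a u v; rewrite !muE form_op_multilinear. Qed.

Lemma eq_poly_value q mu nu : mu =1 nu -> poly_value q mu = poly_value q nu.
Proof. by move=> eq_mu; apply: meval_eq => i; rewrite /struct_const eq_mu. Qed.

Lemma poly_fun_value q : poly_fun (fun M => poly_value q (form_op M)).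
Proof.
apply: (@poly_fun_ext _ _ (fun M => \sum_(m <- msupp q)
    q@_m * \prod_i struct_const (form_op M) (enum_val i) ^+ m i)).
  by move=> M; rewrite /poly_value mevalE.
apply: poly_fun_sum => m; apply: poly_fun_mul (poly_fun_const _ _) _.
apply: poly_fun_prod => i; apply: poly_fun_exp.
set t := enum_val i; rewrite /struct_const /form_op.
by apply: poly_fun_ext (poly_fun_mulmx 1%:M _ t.2 0) => M; rewrite mul1mx.
Qed.

(** The entries of M are, up to sign, structure constants of [form_op M]. *)
Lemma poly_fun_valueP f : poly_fun f ->
  exists q, forall M, f M = poly_value q (form_op M).
Proof.
elim=> [c|i j|f1 f2 _ [q1 Dq1] _ [q2 Dq2]|f1 f2 _ [q1 Dq1] _ [q2 Dq2]|].
- by exists c%:MP => M; rewrite /poly_value mevalC.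
- pose t : sc_index n := ([ffun a => lift j a], i).
  exists ((-1) ^+ j *: 'X_(enum_rank t)) => M.
  rewrite /poly_value mevalZ mevalXU enum_rankK /struct_const /=.
  rewrite (_ : [ffun a => _] = [ffun a => evec F n (lift j a).+1]).
    by rewrite form_op_basis !mxE signrMK.
  by apply/ffunP=> a; rewrite !ffunE.
- by exists (q1 + q2) => M; rewrite Dq1 Dq2 /poly_value mevalD.
- by exists (q1 * q2) => M; rewrite Dq1 Dq2 /poly_value mevalM.
by move=> f1 f2 eq_f _ [q Dq]; exists q => M; rewrite -eq_f.
Qed.

(** Orbits correspond to congruence classes by [orbitP], and polynomials in the
structure constants to polynomial functions of the matrix. *)
Lemma degeneratesP mu lam M L : mu =1 form_op M -> lam =1 form_op L ->
  degenerates mu lam <-> congr_closure M L.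
Proof.
move=> muE lamE; split=> [[_ clZ] f poly_f f0|clL].
  have [q Dq] := poly_fun_valueP poly_f.
  rewrite Dq -(eq_poly_value q lamE).
  apply: (clZ (fun nu => poly_value q nu = 0)) =>
    [|nu /(orbitP nu muE)[K congK nuE]].
    by exists (eq q) => nu _; split=> [q0 _ <-|]; last apply.
  by rewrite (eq_poly_value q nuE) -Dq f0.
split; first exact: multilinear_form lamE.
move=> Z [I ZE] orbZ; apply/ZE => [|q Iq]; first exact: multilinear_form lamE.
rewrite (eq_poly_value q lamE); apply: (clL _ (poly_fun_value q)) => K congK.
apply: (proj1 (ZE _ (form_op_multilinear K))) Iq.
by apply: orbZ; apply/(orbitP _ muE); exists K.
Qed.

Lemma filippov_form_op mu M : mu =1 form_op M -> filippov_mx M -> filippov mu.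
Proof.
move=> muE filM; split; first exact: multilinear_form muE.
  by move=> s x; rewrite !muE; apply: form_op_anticommutative.
move=> x y; rewrite !muE (filippov_mx_identity filM).
by apply: eq_bigr => i _; rewrite !muE.
Qed.

Lemma filippov_form_dichotomy mu : filippov mu -> exists2 M, mu =1 form_op M &
  M^T = M \/ exists2 B : 'M[F]_2, B^T != B & congr_mx (corner_mx p.+1 B) M.
Proof.
move=> [lin_mu anti_mu id_mu].
have muE := form_opK (two_neq0 F) lin_mu anti_mu.
exists (form_mx mu) => //;
  apply: corner_mxP => [|a b i j]; first exact: two_neq0.
apply: filippov_cyclic => x y; rewrite -!muE id_mu.
by apply: eq_bigr => k _; rewrite -!muE.
Qed.

(** Here A = 0, and the trace of a symmetric matrix times a skew one is zero.
*)
Lemma filippov_mx_symmetric M : M^T = M -> filippov_mx M.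
Proof.
move=> symM W antiW; rewrite symM subrr mulmx0.
suff -> : \tr (M *m W) = 0 by rewrite scale0r.
have: \tr (M *m W) = - \tr (M *m W).
  by rewrite -{1}mxtrace_tr trmx_mul antiW symM mulNmx mxtrace_mulC raddfN.
move/eqP; rewrite -addr_eq0 -mulr2n -mulr_natr mulf_eq0 (negPf (two_neq0 F)).
by rewrite orbF => /eqP.
Qed.

(** In dimension two a 3-form vanishes; concretely, skew matrices are multiples
of a single one. *)
Lemma filippov_mx_dim2 (B : 'M[F]_2) : filippov_mx B.
Proof.
move=> W antiW.
have W_E i j : W j i = - W i j by move/matrixP/(_ i j): antiW; rewrite !mxE.
have diagW i : W i i = 0.
  apply: (mulfI (two_neq0 F)); rewrite mulr0 mulr_natl mulr2n.
  by apply/eqP; rewrite addr_eq0 -W_E.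
have -> : W = mx2 0 (W 0 1) (- W 0 1) 0 by rewrite [LHS]mx2_eta !diagW -W_E.
rewrite [B]mx2_eta; move: (B 0 0) (B 0 1) (B 1 0) (B 1 1) (W 0 1) => a b c d w.
have -> : mx2 a b c d - (mx2 a b c d)^T = mx2 0 (b - c) (c - b) 0.
  by rewrite tr_mx2 [LHS]mx2_eta !mxE /= !subrr.
rewrite !mul_mx2 [RHS]mx2_eta /mxtrace !big_ord_recl big_ord0 !mxE /=.
by congr mx2; ring.
Qed.

Lemma filippov_mx_corner (B : 'M[F]_2) : filippov_mx (corner_mx p.+1 B).
Proof.
move=> W; rewrite -[W]submxK; set W1 := ulsubmx W.
rewrite tr_block_mx opp_block_mx => /eq_block_mx[antiW1 _ _ _].
rewrite /corner_mx tr_block_mx !trmx0 opp_block_mx add_block_mx !mulmx_block.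
rewrite !(mul0mx, mulmx0, addr0, oppr0) filippov_mx_dim2 //.
by rewrite mxtrace_block mxtrace0 addr0 scale_block_mx !scaler0.
Qed.

End OperationsAsForms.

(** * A quadric separating the non-symmetric forms *)

Section Invariants.

Variable F : numClosedFieldType.

(** A 2 x 2 minor of M plus a times the product of the matching coordinates of
A = M - M^T. For a form carried by the plane of A, both are multiples of the
same product of two coordinates of that plane, so the sum vanishes for exactly
one a. The conditions are indexed by vectors rather than by basis indices to
make their invariance under congruence immediate. *)
Definition quadric N (a : F) (M : 'M[F]_N) (x y z w : 'rV[F]_N) : F :=
  let f u v := (u *m M *m v^T) 0 0 in
  f x z * f y w - f x w * f y z + a * ((f x y - f y x) * (f z w - f w z)).

Lemma congr_closure_quadric N a (M L : 'M[F]_N) :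
    (forall x y z w, quadric a M x y z w = 0) -> congr_closure M L ->
  forall x y z w, quadric a L x y z w = 0.
Proof.
move=> M0 clL x y z w.
apply: (clL (fun K => quadric a K x y z w)) => [|_ [h _ ->]].
  have Pm u v := poly_fun_mulmx u v^T 0 0.
  have poly_sub f g :
      poly_fun f -> poly_fun g -> @poly_fun F N (fun K => f K - g K).
    by move=> ? ?; apply: poly_fun_add => //; apply: poly_fun_opp.
  apply: poly_fun_add; first by apply: poly_sub; apply: poly_fun_mul.
  apply: poly_fun_mul (poly_fun_const _ _) _.
  by apply: poly_fun_mul; apply: poly_sub.
rewrite -(M0 (x *m h) (y *m h) (z *m h) (w *m h)) /quadric.
by rewrite !trmx_mul !mulmxA.
Qed.

Lemma quadric_C2 m a x y z w : quadric a (corner_mx m (mx_C2 a)) x y z w = 0.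
Proof.
have formE (u v : 'rV[F]_(2 + m)) : (u *m corner_mx m (mx_C2 a) *m v^T) 0 0 =
    let u0 := u 0 (lshift m 0) in let u1 := u 0 (lshift m 1) in
    let v0 := v 0 (lshift m 0) in let v1 := v 0 (lshift m 1) in
    a * u0 * v0 + u1 * v0 - u1 * v1.
  rewrite -[u]hsubmxK -[v]hsubmxK tr_row_mx mul_row_block !mulmx0 !addr0.
  rewrite mul_row_col mul0mx addr0 !row_mxEl.
  move: (lsubmx u) (lsubmx v) => {}u {}v.
  rewrite mxE !big_ord_recl big_ord0 !mxE !big_ord_recl !big_ord0 !mxE /=.
  rewrite (_ : lift ord0 ord0 = 1 :> 'I_2); last exact/eqP.
  by rewrite -[ord0]/(0 : 'I_2); ring.
by rewrite /quadric !formE /=; ring.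
Qed.

Lemma quadric_entries N a (M : 'M[F]_N) i j :
  (forall x y z w, quadric a M x y z w = 0) ->
  M i i * M j j - M i j * M j i + a * (M i j - M j i) ^+ 2 = 0.
Proof.
pose e k : 'rV[F]_N := delta_mx 0 k.
have formE k l : (e k *m M *m (e l)^T) 0 0 = M k l.
  by rewrite trmx_delta -rowE -colE !mxE.
move=> /(_ (e i) (e j) (e i) (e j)).
by rewrite /quadric !formE expr2.
Qed.

End Invariants.

(** * The degeneration order on normal forms *)

Section Kinds.

Variables (F : numClosedFieldType) (p : nat).
Local Notation n := p.+2.

(** [Sym r] is the symmetric form of rank r, [Asym a] is the algebra C_2(a),
and [Alt] is the algebra C_3. *)
Inductive kind := Sym of nat | Asym of F | Alt.

(** [pid_mx r] is the identity for all r above the size, so only ranks up to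
n + 1 are distinct normal forms. *)
Definition valid k := if k is Sym r then (r <= n.+1)%N else true.

Definition normal_form k : 'M[F]_n.+1 :=
  match k with
  | Sym r => pid_mx r
  | Asym a => corner_mx p.+1 (mx_C2 a)
  | Alt => corner_mx p.+1 (mx_C3 F)
  end.

(** The existence of a degeneration from [normal_form k] to [normal_form l];
see [normal_congr_closure]. *)
Definition above k l : Prop :=
  match k, l with
  | Sym r, Sym s => (s <= r)%N
  | Asym _, Sym s => (s <= 1)%N
  | Asym a, Asym b => a = b
  | Asym a, Alt => a = - (1 / 4%:R)
  | Alt, Sym s => s = 0%N
  | Alt, Alt => True
  | _, _ => False
  end.

Definition covers k l : Prop :=
  match k, l with
  | Sym r, Sym s => r = s.+1
  | Asym _, Sym s => s = 1%N
  | Asym a, Alt => a = - (1 / 4%:R)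
  | Alt, Sym s => s = 0%N
  | _, _ => False
  end.

Lemma above_anti k l : above k l -> above l k -> k = l.
Proof.
case: k l => [r|a|] [s|b|] //=; last by move=> ->.
by move=> le_sr le_rs; congr Sym; apply/eqP; rewrite eqn_leq le_sr le_rs.
Qed.

Lemma covers_above k l : covers k l -> above k l.
Proof. by case: k l => [r|a|] [s|b|] //= ->. Qed.

Definition strictly_above k l := above k l /\ k <> l.

(** A gap of at least two in rank contains the next rank, and the only other
strict pairs that are not covering, from [Asym a] to [Sym 0], have [Sym 1]
between them. *)
Lemma coversP k l : valid k -> valid l ->
  covers k l <-> strictly_above k l /\
    ~ (exists j, [/\ valid j, strictly_above k j & strictly_above j l]).
Proof.
move=> vk vl; split=> [cov_kl|[[kl neq_kl] min_kl]].
  split.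
    split; first exact: covers_above.
    by case: k l cov_kl {vk vl} => [r|a|] [s|b|] //= -> [] /esym/n_Sn.
  case=> j [_ [kj neq_kj] [jl neq_jl]].
  case: k l cov_kl kj neq_kj jl neq_jl {vk vl} => [r|a|] [s|b|] //= ->;
    case: j => [t|c|] //=.
  - move=> le_ts neq_st le_st neq_ts.
    case: (ltngtP s t) le_st => // [lt_st _|eq_st _].
      by case: neq_st; congr Sym; apply/eqP; rewrite eqn_leq lt_st le_ts.
    by case: neq_ts; rewrite eq_st.
  - move=> le_t1 _ lt_0t; case; congr Sym; apply/eqP.
    by rewrite eqn_leq le_t1.
  - by move=> ->.
  - by move=> <-.
  - by move=> ->.
case: k l kl neq_kl min_kl vk vl => [r|a|] [s|b|] //=.
- move=> le_sr neq_rs min_rs le_rn le_sn; apply/eqP.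
  rewrite eqn_leq; have [lt_sr|le_rs] := ltnP s r; last first.
    by case: neq_rs; congr Sym; apply/eqP; rewrite eqn_leq le_rs.
  rewrite andbT leqNgt; apply/negP => lt_ssr; apply: min_rs.
  exists (Sym s.+1); split=> //=; first exact: leq_trans lt_sr le_rn.
    by split=> // -[def_r]; rewrite def_r ltnn in lt_ssr.
  by split; [apply: leqnSn | case=> /esym/n_Sn].
- case: s => [|[|//]] // _ _ min_a _ _; case: min_a.
  by exists (Sym 1); split.
by move=> -> [].
Qed.

(** The curves for [Asym a]: in the basis i e_2, t e_1 the form tends to
[Sym 1]. For a = -1/4 its symmetric part has rank one with radical spanned by 2
e_1 + e_2, and the basis t e_2, -(2 e_1 + e_2) / t makes that part tend to zero
while the alternating part is constant. *)
Lemma above_closure k l : valid k -> above k l ->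
  congr_closure (normal_form k) (normal_form l).
Proof.
pose hornE := (hornerN, hornerZ, hornerXn, hornerX, hornerC, horner0).
case: k l => [r|a|] [s|b|] //= _; last 1 first.
- by move=> _; apply: congr_closure_refl.
- exact: congr_closure_pid.
- case: s => [_|[_|//]]; first by rewrite pid_mx_0; apply: congr_closure0.
  have -> : pid_mx 1 =
      corner_mx p.+1 (mx2 1%:P.[0] ('i *: 'X).[0] 0.[0] (a *: 'X^2).[0]).
    apply/matrixP=> i j; rewrite corner_mx2E !hornE mxE.
    by case: i j => [[|[|i]] ?] [[|[|j]] ?];
      rewrite //= ?andbF // ?expr0n /= ?mulr0.
  apply: congr_closure_corner => t nzt; rewrite !hornE.
  apply: (@mx2_congr _ _ _ _ _ _ _ _ _ 0 'i t 0); last 4 first.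
  - by rewrite !(mulr0, mul0r, add0r, mulrN1, mulrN) -expr2 sqrCi opprK.
  - by ring.
  - by ring.
  - by ring.
  by rewrite mul0r sub0r oppr_eq0 mulf_neq0 ?neq0Ci.
- by move=> ->; apply: congr_closure_refl.
- move=> ->.
  have -> : mx_C3 F = mx2 (- 'X^2).[0] (-1)%:P.[0] 1%:P.[0] 0.[0].
    by rewrite !hornE expr0n oppr0.
  apply: congr_closure_corner => t nzt; rewrite !hornE.
  have nz4 : 4 != 0 :> F by rewrite pnatr_eq0.
  apply: (@mx2_congr _ _ _ _ _ _ _ _ _ 0 t (- (2 / t)) (- t^-1)).
  - by rewrite mul0r sub0r mulrN opprK mulrCA mulfV // mulr1 (two_neq0 F).
  - by ring.
  - by field; rewrite ?nz4 ?nzt.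
  - by field; rewrite ?nz4 ?nzt.
  by field; rewrite ?nz4 ?nzt.
by move=> ->; rewrite pid_mx_0; apply: congr_closure0.
Qed.

(** Symmetry, skew-symmetry and rank settle the pairs that start from [Sym r]
or [Alt]; the entries (0, 1) of the quadric settle those that start from
[Asym a]. *)
Lemma closure_above k l : valid k -> valid l ->
  congr_closure (normal_form k) (normal_form l) -> above k l.
Proof.
have nz_sum2 : 1 + 1 != 0 :> F := two_neq0 F.
have antiC3 : (corner_mx p.+1 (mx_C3 F))^T = - corner_mx p.+1 (mx_C3 F).
  rewrite /corner_mx tr_block_mx opp_block_mx !trmx0 !oppr0 tr_mx2.
  by congr block_mx; rewrite [RHS]mx2_eta !mxE /= oppr0 opprK.
case: k l => [r|a|] [s|b|] //= vk vl cl.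
- by have := congr_closure_rank cl; rewrite !rank_pid_mx.
- have /matrixP/(_ 0 1) := congr_closure_symmetric (tr_pid_mx _ _ _ _) cl.
  by rewrite mxE !corner_mx2E /= => /eqP; rewrite oner_eq0.
- have /matrixP/(_ 0 1) := congr_closure_symmetric (tr_pid_mx _ _ _ _) cl.
  by rewrite mxE !corner_mx2E /= => /eqP; rewrite -addr_eq0 (negPf nz_sum2).
- rewrite leqNgt; apply/negP => lt_1s.
  have := quadric_entries 0 1 (congr_closure_quadric (@quadric_C2 _ _ a) cl).
  rewrite !mxE /= (ltnW lt_1s) lt_1s mulr1 mulr0 !subr0 expr0n mulr0 addr0.
  by move/eqP; rewrite oner_eq0.
- have := quadric_entries 0 1 (congr_closure_quadric (@quadric_C2 _ _ a) cl).
  rewrite !corner_mx2E /= => eq_ab; apply/eqP; rewrite -subr_eq0 -eq_ab.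
  by apply/eqP; ring.
- have := quadric_entries 0 1 (congr_closure_quadric (@quadric_C2 _ _ a) cl).
  rewrite !corner_mx2E /= => eq_a; have nz4 : 4 != 0 :> F by rewrite pnatr_eq0.
  apply: (mulfI nz4); rewrite mulrN mulrA mulr1 mulfV //.
  by apply/eqP; rewrite -subr_eq0 -eq_a; apply/eqP; ring.
- case: s vl cl => // s vl cl.
  have /matrixP/(_ 0 0) := congr_closure_antisymmetric antiC3 cl.
  by rewrite !mxE /= => /eqP; rewrite -addr_eq0 (negPf nz_sum2).
have /matrixP/(_ 1 1) := congr_closure_antisymmetric antiC3 cl.
rewrite mxE [RHS]mxE !corner_mx2E /= => /eqP; rewrite opprK.
by rewrite -subr_eq0 -opprD oppr_eq0 (negPf nz_sum2).
Qed.

Definition alg_of k : nary_op F n :=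
  match k with
  | Sym 0 => @alg_0 F n
  | Sym 1 => @alg_B F n
  | Sym 2 => @alg_C1 F n
  | Sym r => @alg_D F n r
  | Asym a => @alg_C2 F n a
  | Alt => @alg_C3 F n
  end.

Lemma eq_alt_op (c d : nat -> 'cV[F]_n.+1) : c =1 d -> alt_op c =1 alt_op d.
Proof. by move=> eq_cd x; apply: eq_bigr => k _; rewrite eq_cd. Qed.

(** For the symmetric algebras the matrix is diagonal with alternating signs,
which the change of basis diag (1, i, i^2, ...) absorbs. *)
Lemma alg_ofE k : exists2 M, alg_of k =1 form_op M & congr_mx (normal_form k) M.
Proof.
have algD r : exists2 M, @alg_D F n r =1 form_op M & congr_mx (pid_mx r) M.
  eexists; first exact: alt_opE.
  pose d := \row_(j < n.+1) ('i ^+ j : F).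
  exists (diag_mx d).
    rewrite unitmxE det_diag unitfE; apply/prodf_neq0 => i _.
    by rewrite mxE expf_neq0 ?neq0Ci.
  rewrite tr_diag_mx mul_diag_mx mul_mx_diag.
  apply/matrixP=> i j; rewrite !mxE /=.
  case: ltnP => lt_jr; rewrite mxE ?eqSS; last first.
    by case: eqP => [->|]; rewrite ?(leq_gtF lt_jr) ?andbF !(mulr0, mul0r).
  case: eqP => [->|]; last by rewrite !(mulr0, mul0r).
  by rewrite lt_jr !mulr1 -exprMn -expr2 sqrCi.
case: k => [[|[|[|r]]]|a|] /=.
- by have [M ME congM] := algD 0%N; exists M.
- have [M ME congM] := algD 1%N; exists M => // x; rewrite -ME /alg_B /alg_D.
  by apply: eq_alt_op => -[|[|k]].
- have [M ME congM] := algD 2%N; exists M => // x; rewrite -ME /alg_C1 /alg_D.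
  by apply: eq_alt_op => -[|[|[|k]]].
- exact: algD.
- eexists; first exact: alt_opE.
  rewrite (_ : \matrix_(i, j) _ = corner_mx p.+1 (mx_C2 a)).
    exact: congr_mx_refl.
  apply/matrixP=> i j; rewrite corner_mx2E mxE.
  by case: i j => [[|[|i]] ?] [[|[|j]] ?]; rewrite !mxE /=; ring.
eexists; first exact: alt_opE.
rewrite (_ : \matrix_(i, j) _ = corner_mx p.+1 (mx_C3 F)).
  exact: congr_mx_refl.
apply/matrixP=> i j; rewrite corner_mx2E mxE.
by case: i j => [[|[|i]] ?] [[|[|j]] ?]; rewrite !mxE /=; ring.
Qed.

Lemma covers_listed k l : valid k -> valid l -> covers k l ->
  listed_degeneration (alg_of k) (alg_of l).
Proof.
case: k l => [r|a|] [s|b|] //= vk _.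
- move=> def_r; rewrite def_r in vk *; case: s vk {def_r} => [|[|[|s]]] vk.
  + exact: listed_B_0.
  + exact: listed_C1_B.
  + exact: listed_D3_C1.
  by apply: (@listed_D_D _ _ s.+4); rewrite vk.
- by move=> ->; apply: listed_C2_B.
- by move=> ->; apply: listed_C2_C3.
by move=> ->; apply: listed_C3_0.
Qed.

Lemma listed_covers A B : listed_degeneration A B ->
  exists k l, [/\ valid k, valid l, covers k l, A = alg_of k & B = alg_of l].
Proof.
case=> [r /andP[lt_3r le_rn]||||||].
- case: r lt_3r le_rn => [|[|[|[|r]]]] // _ le_rn.
  by exists (Sym r.+4), (Sym r.+3); split=> //=; apply: ltnW.
- by exists (Sym 3), (Sym 2).
- by exists (Sym 2), (Sym 1).
- by move=> a; exists (Asym a), (Sym 1).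
- by exists (Asym (- (1 / 4%:R))), Alt.
- by exists (Sym 1), (Sym 0).
by exists Alt, (Sym 0).
Qed.

Lemma filippov_mx_normal_form k : filippov_mx (normal_form k).
Proof.
case: k => [r|a|] /=; last 2 first; try exact: filippov_mx_corner.
exact/filippov_mx_symmetric/tr_pid_mx.
Qed.

Lemma filippov_kind mu : filippov mu ->
  exists k M, [/\ valid k, mu =1 form_op M & congr_mx (normal_form k) M].
Proof.
case/filippov_form_dichotomy=> M muE [symM|[B asymB congM]].
  have [r le_rN congM] := symmetric_congr_pid symM.
  by exists (Sym r), M.
have [congB|[a congB]] := asymmetric_mx2 asymB.
  exists Alt, M; split=> //; apply: congr_mx_trans congM.
  exact/corner_mx_congr/congr_mx_sym.
exists (Asym a), M; split=> //; apply: congr_mx_trans congM.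
exact/corner_mx_congr/congr_mx_sym.
Qed.

Lemma normal_congr_closure k l M L : valid k -> valid l ->
    congr_mx (normal_form k) M -> congr_mx (normal_form l) L ->
  congr_closure M L <-> above k l.
Proof.
move=> vk vl congM congL; split=> [cl|/(above_closure vk) cl].
  apply: closure_above => //.
  by apply: congr_closure_congr cl; apply: congr_mx_sym.
exact: congr_closure_congr cl.
Qed.

(** A congruence puts each of the two forms in the closure of the class of the
other, and [above] is antisymmetric. *)
Lemma normal_congr k l M L : valid k -> valid l ->
    congr_mx (normal_form k) M -> congr_mx (normal_form l) L ->
  congr_mx M L <-> k = l.
Proof.
move=> vk vl congM congL; split=> [congML|eq_kl].
  have clM := @congr_closure_refl _ _ M.
  have cl := congr_closure_congr (congr_mx_refl _) congML clM.
  have cl' := congr_closure_congr congML (congr_mx_refl _) clM.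
  by apply: above_anti; apply/normal_congr_closure; eauto.
by apply: congr_mx_trans congL; rewrite -eq_kl; apply: congr_mx_sym.
Qed.

End Kinds.

(** Every Filippov algebra has a normal form, and properness only depends on
normal forms; so primary degenerations are the pairs whose normal forms are a
covering pair. *)
Theorem primary_degenerationP (F : numClosedFieldType) (p : nat)
    (mu lam : nary_op F p.+2) :
  primary_degeneration mu lam <->
  exists A B, [/\ listed_degeneration A B, isomorphic mu A & isomorphic lam B].
Proof.
pose has_kind k (nu : nary_op F p.+2) := valid p k /\
  exists2 M, nu =1 form_op M & congr_mx (normal_form p k) M.
have kind_filippov k nu : has_kind k nu -> filippov nu.
  case=> _ [M nuE congM]; apply: filippov_form_op nuE _.
  by apply: filippov_mx_congr congM _; apply: filippov_mx_normal_form.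
have kind_iso k nu : valid p k ->
    isomorphic nu (@alg_of F p k) <-> has_kind k nu.
  move=> vk; have [K kE congK] := alg_ofE p k; split=> [iso|[_ [M nuE congM]]].
    have [M nuE congM] := isomorphic_form iso kE; split=> //; exists M => //.
    exact: congr_mx_trans congK (congr_mx_sym congM).
  apply/(isomorphicP nuE kE).
  exact: congr_mx_trans (congr_mx_sym congM) congK.
have properP k l nu eta : has_kind k nu -> has_kind l eta ->
    proper_degeneration nu eta <-> strictly_above k l.
  move=> [vk [M nuE congM]] [vl [L etaE congL]].
  have degP := degeneratesP nuE etaE; have isoP := isomorphicP nuE etaE.
  have clP := normal_congr_closure vk vl congM congL.
  have eqP := normal_congr vk vl congM congL.
  by rewrite /proper_degeneration /strictly_above; tauto.
have primaryP k l : has_kind k mu -> has_kind l lam ->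
    primary_degeneration mu lam <-> covers k l.
  move=> kind_mu kind_lam; split=> [[_ _ prop_ml min_ml]|].
    apply/(coversP (proj1 kind_mu) (proj1 kind_lam)); split.
      exact/(properP _ _ _ _ kind_mu kind_lam).
    case=> j [vj kj jl]; case: min_ml; exists (@alg_of F p j).
    have kind_j : has_kind j (@alg_of F p j) by split=> //; apply: alg_ofE.
    split; first exact: kind_filippov kind_j.
      exact/(properP _ _ _ _ kind_mu kind_j).
    exact/(properP _ _ _ _ kind_j kind_lam).
  move/(coversP (proj1 kind_mu) (proj1 kind_lam)) => [kl min_kl].
  split; [exact: kind_filippov kind_mu | exact: kind_filippov kind_lam | |].
    exact/(properP _ _ _ _ kind_mu kind_lam).
  case=> nu [/filippov_kind[j [K [vj nuE congK]]] prop_mn prop_nl].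
  case: min_kl.
  have kind_nu : has_kind j nu by split=> //; exists K.
  exists j; split=> //.
    exact/(properP _ _ _ _ kind_mu kind_nu).
  exact/(properP _ _ _ _ kind_nu kind_lam).
split=> [prim|[A [B [listAB isoA isoB]]]].
  have [fil_mu fil_lam _ _] := prim.
  have [k [M [vk muE congM]]] := filippov_kind fil_mu.
  have [l [L [vl lamE congL]]] := filippov_kind fil_lam.
  have kind_mu : has_kind k mu by split=> //; exists M.
  have kind_lam : has_kind l lam by split=> //; exists L.
  exists (@alg_of F p k), (@alg_of F p l); split; try exact/kind_iso.
  by apply: covers_listed => //; apply/primaryP.
have [k [l [vk vl cov_kl defA defB]]] := listed_covers listAB.
rewrite {}defA {}defB in isoA isoB.
by apply/(primaryP k l) => //; apply/kind_iso.
Qed.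

Theorem theorem7 (R : realType) (n : nat) (hn : (2 <= n)%N)
    (mu lam : nary_op R[i] n) :
  primary_degeneration mu lam <->
  exists A B : nary_op R[i] n,
    [/\ listed_degeneration A B, isomorphic mu A & isomorphic lam B].
Proof.
case: n hn mu lam => [|[|p]] // _ mu lam.
exact: primary_degenerationP.
Qed.
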